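(* Let $P$ be a root poset of coincidental type, i.e., one of $\Phi^+(A_n)$ ($n\geq1$), $\Phi^+(B_n)$ ($n\geq1$), $\Phi^+(H_3)$, $\Phi^+(I_2(m))$ ($m\geq2$), and let $h:=r(P)+2$, where $r(P)$ is the length of a longest chain of $P$ (so $h=n+1$, $2n$, $10$, $m$ respectively). Then for every $\ell\geq1$, the order of $\mathrm{row}\colon\mathrm{PP}^{\ell}(P)\to\mathrm{PP}^{\ell}(P)$ is $2h$ if $P=\Phi^+(A_n)$ with $n\geq2$ or $P=\Phi^+(I_2(m))$ with $m$ odd, and is $h$ if $P=\Phi^+(B_n)$, $P=\Phi^+(H_3)$, or $P=\Phi^+(I_2(m))$ with $m$ even.
   Context: The posets: $\Phi^+(A_n)$ has elements $(i,j)$, $1\leq i\leq j\leq n$, with $(i,j)\leq(i',j')$ iff $i'\leq i$ and $j\leq j'$. $\Phi^+(B_n)$ has elements $(i,j)$ with $1\leq i\leq n$, $i\leq j\leq 2n-i$, and $(i,j)\leq(i',j')$ iff $i'\leq i$ and $j'\leq j$. $\Phi^+(H_3)$ has elements $x_1,\ldots,x_{15}$ with order the transitive closure of the covers: $x_4$ covers $x_1,x_2$; $x_5$ covers $x_2,x_3$; $x_6$ covers $x_4,x_5$; $x_7$ covers $x_5$; $x_8$ covers $x_6,x_7$; $x_9$ covers $x_7$; $x_{10}$ covers $x_8$; $x_{11}$ covers $x_8,x_9$; $x_{12}$ covers $x_{10},x_{11}$; $x_{13}$ covers $x_{12}$; $x_{14}$ covers $x_{13}$; $x_{15}$ covers $x_{14}$.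 $\Phi^+(I_2(m))$ has elements $a,b,c_1,\ldots,c_{m-2}$ with $a,b$ incomparable, $c_1<\cdots<c_{m-2}$ a chain, and $a,b<c_1$ (if $m\geq3$). Rowmotion on $P$-partitions: $\mathrm{PP}^{\ell}(P)$ is the set of weakly order-preserving maps $P\to\{0,1,\ldots,\ell\}$. Let $\widehat P$ be $P$ with a new minimum $\widehat0$ and new maximum $\widehat1$; regard $f\in\mathbb{R}^P$ as a function on $\widehat P$ with $f(\widehat0)=0$, $f(\widehat1)=1$. For $p\in P$ the piecewise-linear toggle $\tau^{\mathrm{PL}}_p\colon\mathbb{R}^P\to\mathbb{R}^P$ fixes $f(q)$ for $q\neq p$ and sets the value at $p$ to $\min\{f(x): x\in\widehat P\text{ covers }p\}+\max\{f(x): p\text{ covers }x\in\widehat P\}-f(p)$. Piecewise-linear rowmotion is $\mathrm{row}^{\mathrm{PL}}=\tau^{\mathrm{PL}}_{p_1}\circ\tau^{\mathrm{PL}}_{p_2}\circ\cdots\circ\tau^{\mathrm{PL}}_{p_N}$ for any linear extension $p_1,\ldots,p_N$ of $P$ (independent of the choice). Then $\mathrm{row}\colon\mathrm{PP}^{\ell}(P)\to\mathrm{PP}^{\ell}(P)$ is defined by $\mathrm{row}(T)=\ell\cdot\mathrm{row}^{\mathrm{PL}}(\tfrac1\ell T)$. *)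

(* Defs.v *)
From HB Require Import structures.
From mathcomp Require Import all_boot all_order all_fingroup all_algebra.
From mathcomp Require Import reals.

Set Implicit Arguments.
Unset Strict Implicit.
Unset Printing Implicit Defensive.

Import Order.TTheory GRing.Theory Num.Theory.

Local Open Scope order_scope.

Definition covers (d : Order.disp_t) (P : finPOrderType d) (x y : P) : bool :=
  (y < x) && [forall z : P, ~~ ((y < z) && (z < x))].

Definition is_chain (d : Order.disp_t) (P : finPOrderType d) (C : {set P}) :=
  [forall x in C, forall y in C, x >=< y].

(* The length of a chain is its number of elements minus one. *)
Definition rank (d : Order.disp_t) (P : finPOrderType d) : nat :=
  (\max_(C : {set P} | is_chain C) #|C|.-1)%N.

Definition hnum (d : Order.disp_t) (P : finPOrderType d) : nat :=
  (rank P + 2)%N.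

Definition linear_extension (d : Order.disp_t) (P : finPOrderType d)
    (s : seq P) : Prop :=
  perm_eq s (enum P) /\ forall x y : P, x <= y -> (index x s <= index y s)%N.

Inductive hat (T : Type) := Hat0 | HatIn of T | Hat1.
Arguments Hat0 {T}.
Arguments Hat1 {T}.

Section HatFin.
Context (T : Type).

Definition hat_code (x : hat T) : option (option T) :=
  match x with Hat0 => Some None | HatIn p => Some (Some p) | Hat1 => None end.

Definition hat_decode (x : option (option T)) : hat T :=
  match x with
  | Some None => Hat0 | Some (Some p) => HatIn p | None => Hat1
  end.

Lemma hat_codeK : cancel hat_code hat_decode.
Proof. by case. Qed.

End HatFin.

HB.instance Definition _ (T : finType) :=
  Finite.copy (hat T) (can_type (@hat_codeK T)).

Section HatOrder.
Context (d : Order.disp_t) (P : finPOrderType d).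

Definition hat_le (x y : hat P) : bool :=
  match x, y with
  | Hat0, _ => true
  | _, Hat1 => true
  | HatIn p, HatIn q => p <= q
  | _, _ => false
  end.

Lemma hat_le_refl : reflexive hat_le.
Proof. by case=> //= p; rewrite lexx. Qed.

Lemma hat_le_anti : antisymmetric hat_le.
Proof. by case=> [|p|] [|q|] //= /le_anti ->. Qed.

Lemma hat_le_trans : transitive hat_le.
Proof. by case=> [|p|] [|q|] [|r|] //=; apply: le_trans. Qed.

HB.instance Definition _ := Order.Le_isPOrder.Build d (hat P)
  hat_le_refl hat_le_anti hat_le_trans.

Lemma hat_leE (x y : hat P) : (x <= y) = hat_le x y.
Proof. by []. Qed.

End HatOrder.

Section FiniteMinMax.
Context (R : realType).

(* The head of the list is only a starting value which is idempotently absorbed;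
   on the empty list both are 0, but they are never used there. *)
Definition min_seq (s : seq R) : R := \big[Num.min/head 0%R s]_(a <- s) a.
Definition max_seq (s : seq R) : R := \big[Num.max/head 0%R s]_(a <- s) a.

Lemma min_seq_mem (s : seq R) : s != [::] -> min_seq s \in s.
Proof.
case: s => // b s _; rewrite /min_seq [head _ _]/= big_seq.
apply: (big_ind (fun a => a \in b :: s)) => [|x y xs ys|//].
  exact: mem_head.
by rewrite /Order.min; case: ifP.
Qed.

Lemma max_seq_mem (s : seq R) : s != [::] -> max_seq s \in s.
Proof.
case: s => // b s _; rewrite /max_seq [head _ _]/= big_seq.
apply: (big_ind (fun a => a \in b :: s)) => [|x y xs ys|//].
  exact: mem_head.
by rewrite /Order.max; case: ifP.
Qed.

Lemma min_seq_le (s : seq R) (a : R) : a \in s -> min_seq s <= a.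
Proof.
rewrite /min_seq; move: (head _ _) => c; elim: s => // x t IH.
rewrite inE big_cons ge_min.
by case/orP => [/eqP ->|/IH ->]; rewrite ?lexx ?orbT.
Qed.

Lemma max_seq_ge (s : seq R) (a : R) : a \in s -> a <= max_seq s.
Proof.
rewrite /max_seq; move: (head _ _) => c; elim: s => // x t IH.
rewrite inE big_cons le_max.
by case/orP => [/eqP ->|/IH ->]; rewrite ?lexx ?orbT.
Qed.

End FiniteMinMax.

Section Covers.
Context (d : Order.disp_t) (Q : finPOrderType d).

Let low (z : Q) := #|[set w : Q | w < z]|.

Let low_lt (y z : Q) : y < z -> (low y < low z)%N.
Proof.
move=> yz; apply: proper_card; apply/properP; split.
  by apply/subsetP => w; rewrite !inE => /lt_trans; apply.
by exists y; rewrite !inE ?ltxx.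
Qed.

Lemma cover_above (p y : Q) : p < y -> exists2 x, covers x p & x <= y.
Proof.
move=> py.
have := @arg_minnP _ y (fun z => (p < z) && (z <= y)) low.
rewrite py lexx => /(_ isT) [x /andP[px xy] xmin].
exists x => //; rewrite /covers px; apply/forallP => z.
apply/negP => /andP[pz zx].
have := xmin z; rewrite pz (le_trans (ltW zx) xy) => /(_ isT).
by rewrite leqNgt low_lt.
Qed.

Lemma cover_below (p y : Q) : y < p -> exists2 x, covers p x & y <= x.
Proof.
move=> yp.
have := @arg_maxnP _ y (fun z => (y <= z) && (z < p)) low.
rewrite yp lexx => /(_ isT) [x /andP[yx xp] xmax].
exists x => //; rewrite /covers xp; apply/forallP => z.
apply/negP => /andP[xz zp].
have := xmax z; rewrite zp (le_trans yx (ltW xz)) => /(_ isT).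
by rewrite /= leqNgt low_lt.
Qed.

End Covers.

Section PiecewiseLinear.
Context (R : realType) (d : Order.disp_t) (P : finPOrderType d).

Definition hat_ext (f : {ffun P -> R}) (x : hat P) : R :=
  match x with Hat0 => 0%R | HatIn p => f p | Hat1 => 1%R end.

Definition min_above (f : {ffun P -> R}) (p : P) : R :=
  min_seq [seq hat_ext f x | x <- enum [pred x : hat P | covers x (HatIn p)]].

Definition max_below (f : {ffun P -> R}) (p : P) : R :=
  max_seq [seq hat_ext f x | x <- enum [pred x : hat P | covers (HatIn p) x]].

Definition toggle_PL (p : P) (f : {ffun P -> R}) : {ffun P -> R} :=
  [ffun q => if q == p then (min_above f p + max_below f p - f p)%R else f q].

(* The last toggle of the list is applied first. *)
Definition row_PL (s : seq P) (f : {ffun P -> R}) : {ffun P -> R} :=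
  foldr toggle_PL f s.

Lemma hat_ext_toggle p f (x : hat P) : x != HatIn p ->
  hat_ext (toggle_PL p f) x = hat_ext f x.
Proof.
by case: x => //= q; rewrite ffunE; case: (q =P p) => // ->; rewrite eqxx.
Qed.

Lemma toggle_PLK p : involutive (toggle_PL p).
Proof.
move=> f; apply/ffunP => q; rewrite ffunE; case: eqP => [->|/eqP/negPf qp].
  have -> : min_above (toggle_PL p f) p = min_above f p.
    congr min_seq; apply/eq_in_map => x; rewrite mem_enum inE => /andP[px _].
    by rewrite hat_ext_toggle // gt_eqF.
  have -> : max_below (toggle_PL p f) p = max_below f p.
    congr max_seq; apply/eq_in_map => x; rewrite mem_enum inE => /andP[px _].
    by rewrite hat_ext_toggle // lt_eqF.
  by rewrite ffunE eqxx opprB addrC subrK.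
by rewrite ffunE qp.
Qed.

Lemma row_PL_inj s : injective (row_PL s).
Proof.
by elim: s => [|p s IH] f g //= /(inv_inj (toggle_PLK p)) /IH.
Qed.

Section Grid.
Context (ell : nat).

Definition grid_point (f : {ffun P -> R}) : Prop :=
  (forall x y : hat P, x <= y -> hat_ext f x <= hat_ext f y) /\
  (forall x : hat P, exists k : nat, hat_ext f x = (k%:R / ell%:R)%R).

Lemma toggle_grid_point p f : grid_point f -> grid_point (toggle_PL p f).
Proof.
case=> fmono fgrid.
pose U := [seq hat_ext f x | x <- enum [pred x : hat P | covers x (HatIn p)]].
pose L := [seq hat_ext f x | x <- enum [pred x : hat P | covers (HatIn p) x]].
have memU x : covers x (HatIn p) -> hat_ext f x \in U.
  by move=> cx; apply: map_f; rewrite mem_enum inE.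
have memL x : covers (HatIn p) x -> hat_ext f x \in L.
  by move=> cx; apply: map_f; rewrite mem_enum inE.
have U0 : U != [::].
  have [|x /memU + _] := @cover_above _ (hat P) (HatIn p) Hat1.
    by rewrite lt_neqAle.
  by case: (U).
have L0 : L != [::].
  have [|x /memL + _] := @cover_below _ (hat P) (HatIn p) Hat0.
    by rewrite lt_neqAle.
  by case: (L).
have /mapP[u] := min_seq_mem U0; rewrite mem_enum inE => /andP[pu _] Eu.
have /mapP[l] := max_seq_mem L0; rewrite mem_enum inE => /andP[lp _] El.
have {}pu := fmono _ _ (ltW pu); have {}lp := fmono _ _ (ltW lp).
have Ev : toggle_PL p f p = (hat_ext f u + hat_ext f l - f p)%R.
  by rewrite ffunE eqxx /min_above -/U Eu /max_below -/L El.
have vu : toggle_PL p f p <= hat_ext f u.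
  by rewrite Ev -addrA gerDl subr_le0.
have lv : hat_ext f l <= toggle_PL p f p.
  by rewrite Ev addrAC lerDr subr_ge0.
split=> [x y xy|x]; last first.
  have [->|xp] := eqVneq x (HatIn p); last by rewrite hat_ext_toggle.
  rewrite /= Ev.
  have [i Ei] := fgrid u; have [j Ej] := fgrid l; have [k Ek] := fgrid (HatIn p).
  move: pu; rewrite /= in Ek *; rewrite Ei Ej Ek => ki.
  case: (posnP ell) => [e0|e0].
    by exists 0%N; rewrite e0 !invr0 !mulr0 addr0 subr0.
  have {}ki : (k <= i)%N.
    by move: ki; rewrite ler_pM2r ?invr_gt0 ?ltr0n // ler_nat.
  exists (i - k + j)%N; rewrite natrD natrB //.
  by rewrite mulrDl mulrBl addrAC.
have [xp|xp] := eqVneq x (HatIn p); have [yp|yp] := eqVneq y (HatIn p).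
- by rewrite xp yp.
- rewrite [X in _ <= X]hat_ext_toggle // xp.
  have [|c /memU cU cy] := @cover_above _ (hat P) (HatIn p) y.
    by rewrite lt_neqAle eq_sym yp -xp.
  apply: le_trans vu _; rewrite -Eu; apply: le_trans (min_seq_le cU) _.
  exact: fmono.
- rewrite [X in X <= _]hat_ext_toggle // yp.
  have [|c /memL cL cy] := @cover_below _ (hat P) (HatIn p) x.
    by rewrite lt_neqAle xp -yp.
  apply: le_trans lv; rewrite -El; apply: le_trans (max_seq_ge cL).
  exact: fmono.
- by rewrite !hat_ext_toggle //; apply: fmono.
Qed.

Lemma row_grid_point s f : grid_point f -> grid_point (row_PL s f).
Proof. by elim: s => // p s IH /IH; apply: toggle_grid_point. Qed.

End Grid.
End PiecewiseLinear.

Definition order_preserving (d : Order.disp_t) (P : finPOrderType d)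
    (ell : nat) (T : {ffun P -> 'I_ell.+1}) : bool :=
  [forall x : P, forall y : P, (x <= y) ==> (T x <= T y)%N].

Definition PP (d : Order.disp_t) (P : finPOrderType d) (ell : nat) :=
  {T : {ffun P -> 'I_ell.+1} | order_preserving T}.

HB.instance Definition _ (d : Order.disp_t) (P : finPOrderType d) (ell : nat) :=
  Finite.on (PP P ell).

Section Rowmotion.
Context (R : realType) (d : Order.disp_t) (P : finPOrderType d).
Context (ell : nat).
Implicit Types (T : PP P ell) (s : seq P).

Definition pp_scale T : {ffun P -> R} :=
  [ffun x => ((val T x)%:R / ell%:R)%R].

Lemma pp_scale_grid_point T : (0 < ell)%N -> grid_point ell (pp_scale T).
Proof.
move=> l0; have l0R : (0 < ell%:R :> R)%R by rewrite ltr0n.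
split=> [x y|[|p|]] /=.
- case: x => [|p|]; case: y => [|q|] //= pq; rewrite ?ffunE ?ler01 //.
  + by rewrite divr_ge0 ?ler0n.
  + rewrite ler_pM2r ?invr_gt0 // ler_nat.
    by have /forallP/(_ p)/forallP/(_ q)/implyP := valP T; apply.
  + by rewrite ler_pdivrMr // mul1r ler_nat -ltnS.
- by exists 0%N; rewrite mul0r.
- by exists (val T p); rewrite ffunE.
- by exists ell; rewrite divff // gt_eqF.
Qed.

Let ord_zero (k : 'I_ell.+1) : ell = 0%N -> k = 0%N :> nat.
Proof. by case: k => k /= + e0; rewrite e0 ltnS leqn0 => /eqP. Qed.

Lemma rowmotion_exists s T : exists U : PP P ell,
  [forall x, ((val U x)%:R == ell%:R * row_PL s (pp_scale T) x)%R].
Proof.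
case: (posnP ell) => [e0|l0].
  have lR0 : (ell%:R = 0 :> R)%R by rewrite e0.
  by exists T; apply/forallP => x; rewrite lR0 mul0r pnatr_eq0 ord_zero.
have [fmono fgrid] := row_grid_point s (pp_scale_grid_point T l0).
set f := row_PL _ _ in fmono fgrid *.
have l0R : (0 < ell%:R :> R)%R by rewrite ltr0n.
have H x : exists k : 'I_ell.+1, (k%:R == ell%:R * f x)%R.
  have [k /= Ek] := fgrid (HatIn x).
  have : f x <= 1%R by apply: (fmono (HatIn x) Hat1).
  rewrite Ek ler_pdivrMr // mul1r ler_nat => kl.
  by exists (Ordinal (kl : (k < ell.+1)%N)); rewrite mulrC divfK // gt_eqF.
pose U := [ffun x => xchoose (H x)] : {ffun P -> 'I_ell.+1}.
have UE x : ((U x)%:R = ell%:R * f x)%R.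
  by rewrite ffunE; apply/eqP; apply: (xchooseP (H x)).
have Uop : order_preserving U.
  apply/forallP => x; apply/forallP => y; apply/implyP => xy.
  rewrite -(ler_nat R) !UE ler_pM2l //.
  exact: (fmono (HatIn x) (HatIn y)).
by exists (exist _ U Uop); apply/forallP => x; rewrite UE.
Qed.

(* The unique element of PP P ell that is equal, as a real-valued function, to
   ell * row_PL s (T / ell); see rowmotionE. *)
Definition rowmotion s T : PP P ell := xchoose (rowmotion_exists s T).

Lemma rowmotionE s T x :
  ((val (rowmotion s T) x)%:R = ell%:R * row_PL s (pp_scale T) x)%R.
Proof. by have /forallP/(_ x)/eqP := xchooseP (rowmotion_exists s T). Qed.

Lemma rowmotion_inj s : injective (rowmotion s).
Proof.
move=> T U E; apply: val_inj; apply/ffunP => x; apply: ord_inj.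
case: (posnP ell) => [e0|l0].
  by rewrite !ord_zero.
have l0R : (ell%:R != 0 :> R)%R by rewrite pnatr_eq0 -lt0n.
have /row_PL_inj/ffunP/(_ x) : row_PL s (pp_scale T) = row_PL s (pp_scale U).
  by apply/ffunP => y; apply: (mulfI l0R); rewrite -!rowmotionE E.
by rewrite !ffunE => /(mulIf (invr_neq0 l0R))/eqP; rewrite eqr_nat => /eqP.
Qed.

Definition rowmotion_perm s : {perm PP P ell} := perm (@rowmotion_inj s).

End Rowmotion.

Arguments rowmotion_perm R {d P} ell s.

Fact root_display : Order.disp_t. Proof. exact: Order.Disp tt tt. Qed.

Definition PhiA (n : nat) :=
  {p : 'I_n.+1 * 'I_n.+1 | (1 <= p.1)%N && (p.1 <= p.2)%N}.

HB.instance Definition _ (n : nat) := Finite.on (PhiA n).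

Section PhiAOrder.
Context (n : nat).

Definition PhiA_le (p q : PhiA n) : bool :=
  ((val q).1 <= (val p).1)%N && ((val p).2 <= (val q).2)%N.

Lemma PhiA_le_refl : reflexive PhiA_le.
Proof. by move=> p; rewrite /PhiA_le !leqnn. Qed.

Lemma PhiA_le_anti : antisymmetric PhiA_le.
Proof.
move=> p q /andP[/andP[a b] /andP[c e]]; apply: val_inj.
apply/eqP; rewrite -pair_eqE /pair_eq /= -!val_eqE /= !eqn_leq.
by rewrite a b c e.
Qed.

Lemma PhiA_le_trans : transitive PhiA_le.
Proof.
move=> q p r /andP[a b] /andP[c e].
by rewrite /PhiA_le (leq_trans c a) (leq_trans b e).
Qed.

HB.instance Definition _ := Order.Le_isPOrder.Build root_display (PhiA n)
  PhiA_le_refl PhiA_le_anti PhiA_le_trans.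

Lemma PhiA_leE (x y : PhiA n) : (x <= y) = PhiA_le x y.
Proof. by []. Qed.

End PhiAOrder.

Definition PhiB (n : nat) :=
  {p : 'I_n.+1 * 'I_(2 * n).+1 |
     (1 <= p.1)%N && (p.1 <= p.2 <= 2 * n - p.1)%N}.

HB.instance Definition _ (n : nat) := Finite.on (PhiB n).

Section PhiBOrder.
Context (n : nat).

(* Both inequalities are reversed. This is the usual root order after the
   substitution j |-> 2n - j, which preserves the carrier. *)
Definition PhiB_le (p q : PhiB n) : bool :=
  ((val q).1 <= (val p).1)%N && ((val q).2 <= (val p).2)%N.

Lemma PhiB_le_refl : reflexive PhiB_le.
Proof. by move=> p; rewrite /PhiB_le !leqnn. Qed.

Lemma PhiB_le_anti : antisymmetric PhiB_le.
Proof.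
move=> p q /andP[/andP[a b] /andP[c e]]; apply: val_inj.
apply/eqP; rewrite -pair_eqE /pair_eq /= -!val_eqE /= !eqn_leq.
by rewrite a b c e.
Qed.

Lemma PhiB_le_trans : transitive PhiB_le.
Proof.
move=> q p r /andP[a b] /andP[c e].
by rewrite /PhiB_le (leq_trans c a) (leq_trans e b).
Qed.

HB.instance Definition _ := Order.Le_isPOrder.Build root_display (PhiB n)
  PhiB_le_refl PhiB_le_anti PhiB_le_trans.

Lemma PhiB_leE (x y : PhiB n) : (x <= y) = PhiB_le x y.
Proof. by []. Qed.

End PhiBOrder.

(* The ordinal k : 'I_15 stands for x_(k+1). *)
Definition PhiH3 := 'I_15.

HB.instance Definition _ := Finite.on PhiH3.

(* (k, l) means that x_k covers x_l. *)
Definition H3_covers : seq (nat * nat) :=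
  [:: (4, 1); (4, 2); (5, 2); (5, 3); (6, 4); (6, 5); (7, 5); (8, 6); (8, 7);
      (9, 7); (10, 8); (11, 8); (11, 9); (12, 10); (12, 11); (13, 12);
      (14, 13); (15, 14)]%N.

Definition H3_covered : rel PhiH3 :=
  fun x y => ((y : nat).+1, (x : nat).+1) \in H3_covers.

(* connect is the reflexive transitive closure. *)
Definition PhiH3_le : rel PhiH3 := connect H3_covered.

Lemma PhiH3_le_ltn (x y : PhiH3) : PhiH3_le x y -> (x <= y)%N.
Proof.
case/connectP => s + ->; elim: s x => //= z s IH x /andP[xz /IH].
apply: leq_trans; move: xz; rewrite /H3_covered.
have : all (fun p : nat * nat => (p.2 <= p.1)%N) H3_covers by [].
by move=> /allP H /H.
Qed.

Lemma PhiH3_le_refl : reflexive PhiH3_le.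
Proof. exact: connect0. Qed.

Lemma PhiH3_le_anti : antisymmetric PhiH3_le.
Proof.
move=> x y /andP[/PhiH3_le_ltn a /PhiH3_le_ltn b].
by apply/ord_inj/eqP; rewrite eqn_leq a b.
Qed.

Lemma PhiH3_le_trans : transitive PhiH3_le.
Proof. exact: connect_trans. Qed.

HB.instance Definition _ := Order.Le_isPOrder.Build root_display PhiH3
  PhiH3_le_refl PhiH3_le_anti PhiH3_le_trans.

Lemma PhiH3_leE (x y : PhiH3) : (x <= y) = PhiH3_le x y.
Proof. by []. Qed.

(* a = inl true, b = inl false, and c_(k+1) = inr k. *)
Definition PhiI2 (m : nat) := (bool + 'I_(m - 2))%type.

HB.instance Definition _ (m : nat) := Finite.on (PhiI2 m).

Section PhiI2Order.
Context (m : nat).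

Definition PhiI2_le (x y : PhiI2 m) : bool :=
  match x, y with
  | inl u, inl v => u == v
  | inl _, inr _ => true
  | inr _, inl _ => false
  | inr i, inr j => (i <= j)%N
  end.

Lemma PhiI2_le_refl : reflexive PhiI2_le.
Proof. by case=> [u|i] /=. Qed.

Lemma PhiI2_le_anti : antisymmetric PhiI2_le.
Proof.
case=> [u|i] [v|j] //= => [/andP[/eqP -> //]|ij].
by congr inr; apply/ord_inj/eqP; rewrite eqn_leq.
Qed.

Lemma PhiI2_le_trans : transitive PhiI2_le.
Proof.
case=> [u|i] [v|j] [w|k] //=; first by move=> /eqP -> /eqP ->.
exact: leq_trans.
Qed.

HB.instance Definition _ := Order.Le_isPOrder.Build root_display (PhiI2 m)
  PhiI2_le_refl PhiI2_le_anti PhiI2_le_trans.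

Lemma PhiI2_leE (x y : PhiI2 m) : (x <= y) = PhiI2_le x y.
Proof. by []. Qed.

End PhiI2Order.

(* Main.v *)
(* Rowmotion takes f to the unique g with
     g p + f p = min {g x : x covers p} + max {f x : p covers x},
   where the added bottom and top have the values 0 and ell. After the affine
   change f -> (r + 2) f - ell (rk + 1) both of them have the value 0. The zero
   map has an orbit of size exactly h = r + 2, so h divides the order, and what
   remains is to prove periodicity (up to a symmetry of the poset).

   An integral orbit f_t is the exponent of a family of orbits x_t(z) ~ z^(f_t)
   of the birational analogue of the recurrence, so that every monomial identity
   between birational orbits gives a linear one between the f_t.

   On an N x N square, the path sums of x_t from one edge to the opposite one are
   shifted along these edges when t increases, which yields the reciprocity
   x_(t+i+k-1)(i, k) x_t(N+1-i, N+1-k) = 1. The root poset of type A_n is the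
   part above the antidiagonal of a square with N = n + 1, and reciprocity says
   that h steps of rowmotion reflect it. The labellings of type B_n are those of
   type A_(2n-1) that are invariant under this reflection. For I_2(m), any m
   consecutive values at the maximum have the same sum. For H_3 the birational
   orbits are parametrized by the solutions of a system of algebraic recurrences,
   which are explicit Laurent polynomials in fifteen variables and 10-periodic. *)

Require Import Defs.
From mathcomp Require Import all_boot all_order all_fingroup all_algebra.
From mathcomp Require Import cyclic reals.
From mathcomp Require Import zify ring lra.

Set Implicit Arguments.
Unset Strict Implicit.
Unset Printing Implicit Defensive.

Import Order.TTheory GRing.Theory Num.Theory.

(** * Piecewise-linear steps on graded graphs *)

(** The default [d] is the value of the added bottom or top, the only neighbour of an extremal
    vertex on that side. *)
Definition fold1 (T : Type) (op : T -> T -> T) (d : T) (s : seq T) : T :=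
  if s is x :: s' then foldr op x s' else d.

Definition minl (d : int) (s : seq int) : int := fold1 Num.min d s.
Definition maxl (d : int) (s : seq int) : int := fold1 Num.max d s.

Section ListExtrema.
Local Open Scope ring_scope.

Lemma minl_mem d s : s != [::] -> minl d s \in s.
Proof.
case: s => // x s _; rewrite /minl /=; elim: s => [|y s IH] /=.
  by rewrite mem_head.
rewrite /Order.min; case: ifP => _; rewrite !inE ?eqxx ?orbT //.
by move: IH; rewrite inE => /orP[->|->]; rewrite ?orbT.
Qed.

Lemma minl_le d s a : a \in s -> minl d s <= a.
Proof.
case: s => // x s; rewrite /minl /=; elim: s a => [|y s IH] a /=.
  by rewrite inE => /eqP ->.
rewrite !inE ge_min => /or3P[/eqP->|/eqP->|ys]; rewrite ?lexx //.
  by rewrite IH ?orbT // mem_head.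
by rewrite IH ?orbT // inE ys orbT.
Qed.

Lemma minlE d s m : m \in s -> (forall a, a \in s -> m <= a) -> minl d s = m.
Proof.
move=> ms ml; apply/le_anti; rewrite minl_le // ml // minl_mem //.
by case: s ms {ml}.
Qed.

Lemma maxl_opp d s : maxl d s = - minl (- d) [seq - a | a <- s].
Proof.
case: s => [|x s]; rewrite /maxl /minl /= ?opprK //.
by elim: s => [|y s IH] /=; rewrite ?opprK // IH oppr_min opprK.
Qed.

Lemma maxlE d s m : m \in s -> (forall a, a \in s -> a <= m) -> maxl d s = m.
Proof.
move=> ms ml; rewrite maxl_opp; apply/eqP; rewrite eqr_oppLR; apply/eqP.
apply: minlE; first by rewrite mem_map //; exact: oppr_inj.
by move=> _ /mapP[a /ml am ->]; rewrite lerN2.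
Qed.

Lemma minl_affine (c b : int) d s : 0 <= c ->
  minl (c * d + b) [seq c * a + b | a <- s] = c * minl d s + b.
Proof.
move=> c0; case: s => [|x s] //; rewrite /minl /=.
by elim: s => //= y s ->; rewrite minr_pMr // addr_minl.
Qed.

Lemma maxl_affine (c b : int) d s : 0 <= c ->
  maxl (c * d + b) [seq c * a + b | a <- s] = c * maxl d s + b.
Proof.
move=> c0; rewrite !maxl_opp -map_comp opprD -mulrN.
rewrite (eq_map (_ : _ =1 (fun a => c * a - b) \o -%R)); last first.
  by move=> a /=; rewrite opprD mulrN.
by rewrite map_comp minl_affine // opprD opprK mulrN.
Qed.

Lemma minl_default d' d s : s != [::] -> minl d s = minl d' s.
Proof. by case: s. Qed.

Lemma maxl_default d' d s : s != [::] -> maxl d s = maxl d' s.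
Proof. by case: s. Qed.

Lemma minl_const (T : eqType) (f : T -> int) c d s :
  (forall a, a \in s -> f a = c) -> (s = [::] -> d = c) -> minl d (map f s) = c.
Proof.
case: s => [|x s] fc dc; first exact: dc.
apply: minlE; first by rewrite -(fc x) ?map_f ?mem_head.
by move=> _ /mapP[a /fc <- ->].
Qed.

Lemma maxl_const (T : eqType) (f : T -> int) c d s :
  (forall a, a \in s -> f a = c) -> (s = [::] -> d = c) -> maxl d (map f s) = c.
Proof.
case: s => [|x s] fc dc; first exact: dc.
apply: maxlE; first by rewrite -(fc x) ?map_f ?mem_head.
by move=> _ /mapP[a /fc <- ->].
Qed.

End ListExtrema.

(** Vertices are plain coordinates restricted by [dom], so that arithmetic decides adjacency. All
    maximal vertices have rank [top] and all minimal ones rank 0, on which the affine change in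
    [normalize] relies. *)
Record cover_graph (V : eqType) := CoverGraph {
  dom : pred V;
  up : V -> seq V;
  low : V -> seq V;
  rk : V -> nat;
  top : nat;
  up_dom : forall v w, dom v -> w \in up v -> dom w;
  low_dom : forall v w, dom v -> w \in low v -> dom w;
  up_rk : forall v w, dom v -> w \in up v -> rk w = (rk v).+1;
  low_rk : forall v w, dom v -> w \in low v -> rk v = (rk w).+1;
  up_nil : forall v, dom v -> up v = [::] -> rk v = top;
  low_nil : forall v, dom v -> low v = [::] -> rk v = 0;
  rk_top : forall v, dom v -> rk v <= top
}.

Lemma down_ind (V : eqType) (G : cover_graph V) (Q : V -> Prop) :
  (forall v, dom G v -> (forall w, w \in up G v -> Q w) -> Q v) ->
  forall v, dom G v -> Q v.
Proof.
move=> step v; have [k] := ubnP (top G - rk G v).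
elim: k v => // k IH v; rewrite ltnS => vk Dv; apply: step => // w wv.
have := up_rk Dv wv; have := rk_top (up_dom Dv wv) => wt wr.
by apply: IH; [lia|exact: up_dom wv].
Qed.

Section PLStep.
Context (V : eqType) (G : cover_graph V).
Local Open Scope ring_scope.

Definition PLstep (L : int) (f g : V -> int) : Prop := forall v, dom G v ->
  g v + f v = minl L (map g (up G v)) + maxl 0 (map f (low G v)).

(** The value of [g] at a vertex depends only on old values and on the values of [g] above it, so
    descending induction determines it. *)
Lemma PLstep_inj L f f' g g' : PLstep L f g -> PLstep L f' g' ->
  {in dom G, f =1 f'} -> {in dom G, g =1 g'}.
Proof.
move=> fg fg' ff' v; move: v; apply: down_ind => v Dv IH.
apply: (addIr (f v)); rewrite fg // [in RHS]ff' // fg' //; congr (minl _ _ + maxl _ _).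
  by apply/eq_in_map => w /IH.
by apply/eq_in_map => w wv; apply: ff'; apply: low_dom wv.
Qed.

Definition normalize (L : int) (f : V -> int) (v : V) : int :=
  (top G).+2%:Z * f v - L * (rk G v).+1%:Z.

(** Scaling by a nonnegative constant and a common shift commute with min and max. The shifts at
    ranks rk + 1 and rk - 1 add up to twice the shift at rank rk, and the same formula sends the
    value [L] at rank [top] + 1 and the value 0 at rank -1 to 0. *)
Lemma normalize_step L f g : PLstep L f g ->
  PLstep 0 (normalize L f) (normalize L g).
Proof.
move=> fg v Dv; pose c := (top G).+2%:Z.
have -> : minl 0 (map (normalize L g) (up G v)) =
    c * minl L (map g (up G v)) - L * (rk G v).+2%:Z.
  rewrite -minl_affine // -map_comp.
  case E: (up G v) => [|x s]; first by rewrite /minl /= /c (up_nil Dv E) mulrC subrr.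
  rewrite -E (@minl_default (c * L - L * (rk G v).+2%:Z)) ?E // -E.
  by congr minl; apply/eq_in_map => w wv; rewrite /= /normalize (up_rk Dv wv).
have -> : maxl 0 (map (normalize L f) (low G v)) =
    c * maxl 0 (map f (low G v)) - L * (rk G v)%:Z.
  rewrite -maxl_affine // -map_comp.
  case E: (low G v) => [|x s].
    by rewrite /maxl /= (low_nil Dv E) !mulr0 subr0.
  rewrite -E (@maxl_default (c * 0 - L * (rk G v)%:Z)) ?E // -E.
  by congr maxl; apply/eq_in_map => w wv; rewrite /= /normalize (low_rk Dv wv).
have := fg v Dv; rewrite /normalize -/c.
move: (minl _ _) (maxl _ _) => a b fga.
have -> : c * g v - L * (rk G v).+1%:Z + (c * f v - L * (rk G v).+1%:Z) =
  c * (g v + f v) - L * (rk G v).+1%:Z - L * (rk G v).+1%:Z by ring.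
by rewrite fga -[(rk G v).+2]addn2 -[(rk G v).+1]addn1 !PoszD; ring.
Qed.

Lemma normalize_inj L f g v : normalize L f v = normalize L g v -> f v = g v.
Proof. by rewrite /normalize => /addIr/mulfI; apply. Qed.

End PLStep.

(** * Rowmotion as a piecewise-linear step *)

Section RowStep.
Context (R : realType) (d : Order.disp_t) (P : finPOrderType d).
Local Open Scope ring_scope.
Implicit Types (f g : {ffun P -> R}) (s : seq P) (p w : P).

Lemma lt_HatIn p w : (HatIn p < HatIn w)%O = (p < w)%O.
Proof. by rewrite !lt_neqAle. Qed.

Lemma lt_Hat0 p : (Hat0 < HatIn p)%O.
Proof. by rewrite lt_neqAle. Qed.

Lemma lt_Hat1 p : (HatIn p < Hat1)%O.
Proof. by rewrite lt_neqAle. Qed.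

Lemma row_PL_notin s f p : p \notin s -> row_PL s f p = f p.
Proof.
elim: s => //= q s IH; rewrite inE negb_or => /andP[/negPf pq ps].
by rewrite ffunE pq IH.
Qed.

Lemma eq_min_above f g p :
  (forall w, (p < w)%O -> f w = g w) -> min_above f p = min_above g p.
Proof.
move=> fg; congr min_seq; apply/eq_in_map => x.
by rewrite mem_enum inE => /andP[px _]; case: x px => //= w; rewrite lt_HatIn => /fg.
Qed.

Lemma eq_max_below f g p :
  (forall w, (w < p)%O -> f w = g w) -> max_below f p = max_below g p.
Proof.
move=> fg; congr max_seq; apply/eq_in_map => x.
by rewrite mem_enum inE => /andP[px _]; case: x px => //= w; rewrite lt_HatIn => /fg.
Qed.

(* When p is toggled, everything above it already has its new value and
   everything below it still has its old one. *)
Lemma row_PL_step s f p : linear_extension s ->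
  row_PL s f p = min_above (row_PL s f) p + max_below f p - f p.
Proof.
case=> sP sle.
have su : uniq s by rewrite (perm_uniq sP) enum_uniq.
have ps : p \in s by rewrite (perm_mem sP) mem_enum.
have := sle; have := su; case/splitPr: {su sle sP} s / ps => s1 s2.
rewrite cat_uniq /= negb_or => /and3P[_ /andP[ps1 s12] /andP[ps2 _]] sle.
have ip : index p (s1 ++ p :: s2) = size s1.
  by rewrite index_cat (negPf ps1) /= eqxx addn0.
have in1 w : w \in s1 -> (index w (s1 ++ p :: s2) < size s1)%N.
  by move=> ws; rewrite index_cat ws index_mem.
have in2 w : w \in s2 -> (size s1 < index w (s1 ++ p :: s2))%N.
  move=> ws; rewrite index_cat ifN; last first.
    by apply: contra s12 => ws1; apply/hasP; exists w.
  rewrite /= ifN; first by rewrite addnS ltnS leq_addr.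
  by apply: contraNneq ps2 => ->.
rewrite /row_PL foldr_cat /= -/(row_PL _ _) -/(row_PL _ _).
set h := row_PL s2 f.
rewrite (row_PL_notin _ ps1) ffunE eqxx; congr (_ + _ - _).
- apply: eq_min_above => w pw; rewrite row_PL_notin ?ffunE ?gt_eqF //.
  apply/negP => /in1; rewrite ltnNge -ip => /negP; apply.
  exact/sle/ltW.
- apply: eq_max_below => w wp; rewrite /h row_PL_notin //.
  apply/negP => /in2; rewrite ltnNge -ip => /negP; apply.
  exact/sle/ltW.
- exact: row_PL_notin.
Qed.

Lemma covers_HatIn (p w : P) : covers (HatIn w) (HatIn p) = covers w p.
Proof.
rewrite /covers lt_HatIn; congr (_ && _); apply/forallP/forallP => H z.
  by rewrite -!lt_HatIn.
by case: z => [|z|] //; rewrite ?lt_HatIn // andbC.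
Qed.

Lemma covers_Hat1 (p : P) : covers Hat1 (HatIn p) = [forall w, ~~ covers w p].
Proof.
apply/idP/forallP => [/andP[_ /forallP H] w|H].
  by have := H (HatIn w); rewrite lt_HatIn lt_Hat1 andbT; apply: contra => /andP[].
rewrite /covers lt_Hat1; apply/forallP => -[|z|] //.
rewrite lt_HatIn lt_Hat1 andbT; apply/negP => /cover_above[x cx _].
by have := H x; rewrite cx.
Qed.

Lemma covers_Hat0 (p : P) : covers (HatIn p) Hat0 = [forall w, ~~ covers p w].
Proof.
apply/idP/forallP => [/andP[_ /forallP H] w|H].
  by have := H (HatIn w); rewrite lt_HatIn lt_Hat0; apply: contra => /andP[].
rewrite /covers lt_Hat0; apply/forallP => -[|z|] //.
rewrite lt_HatIn lt_Hat0 /=; apply/negP => /cover_below[x cx _].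
by have := H x; rewrite cx.
Qed.

End RowStep.

Section RowmotionInt.
Context (R : realType) (d : Order.disp_t) (P : finPOrderType d).
Context (ell : nat) (ell_gt0 : (0 < ell)%N).
Local Open Scope ring_scope.
Implicit Types (T U : PP P ell) (s : seq P) (p w : P).

Definition hat_int T (x : hat P) : int :=
  match x with Hat0 => 0 | HatIn p => (val T p)%:Z | Hat1 => ell%:Z end.

Lemma hat_ext_scale T x : ell%:R * hat_ext (pp_scale R T) x = (hat_int T x)%:~R.
Proof.
have l0 : (ell%:R != 0 :> R) by rewrite pnatr_eq0 -lt0n.
by case: x => [|p|] /=; rewrite ?ffunE ?mulr0 ?mulr1 // mulrC divfK.
Qed.

Lemma pp_scale_rowmotion s T : pp_scale R (rowmotion R s T) = row_PL s (pp_scale R T).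
Proof.
have l0 : (ell%:R != 0 :> R) by rewrite pnatr_eq0 -lt0n.
by apply/ffunP => p; rewrite ffunE rowmotionE mulrC mulKf.
Qed.

(** This is [row_PL_step] multiplied by [ell]. Exhibiting covers that attain the two extrema makes
    it independent of how the covers are listed. *)
Lemma rowmotion_int_step s T p : linear_extension s ->
  let U := rowmotion R s T in
  exists x y : hat P, [/\ covers x (HatIn p), covers (HatIn p) y,
    forall z, covers z (HatIn p) -> hat_int U x <= hat_int U z,
    forall z, covers (HatIn p) z -> hat_int T z <= hat_int T y &
    (val U p)%:Z + (val T p)%:Z = hat_int U x + hat_int T y].
Proof.
move=> sle U; set f := pp_scale R T; set g := pp_scale R U.
have l0 : (0 < ell%:R :> R) by rewrite ltr0n.
pose A := [seq hat_ext g x | x <- enum [pred x : hat P | covers x (HatIn p)]].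
pose B := [seq hat_ext f x | x <- enum [pred x : hat P | covers (HatIn p) x]].
have A0 : A != [::].
  have [x xp _] := cover_above (lt_Hat1 p).
  have : hat_ext g x \in A by rewrite map_f // mem_enum inE.
  by case: (A).
have B0 : B != [::].
  have [x xp _] := cover_below (lt_Hat0 p).
  have : hat_ext f x \in B by rewrite map_f // mem_enum inE.
  by case: (B).
have /mapP[x] := min_seq_mem A0; rewrite mem_enum inE => xp Ex.
have /mapP[y] := max_seq_mem B0; rewrite mem_enum inE => py Ey.
exists x, y; split=> // [z zp|z pz|].
- rewrite -(ler_int R) -!hat_ext_scale ler_pM2l // -/g -Ex min_seq_le //.
  by rewrite map_f // mem_enum inE.
- rewrite -(ler_int R) -!hat_ext_scale ler_pM2l // -/f -Ey max_seq_ge //.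
  by rewrite map_f // mem_enum inE.
- apply/eqP; rewrite -(eqr_int R) !rmorphD /= -!hat_ext_scale -/f -/g -Ex -Ey.
  rewrite -[(val U p)%:~R](hat_ext_scale U (HatIn p)).
  rewrite -[(val T p)%:~R](hat_ext_scale T (HatIn p)) -!mulrDr /=.
  apply/eqP; congr (_ * _); rewrite -/f -/g.
  have gE : g = row_PL s f by rewrite /g pp_scale_rowmotion.
  by rewrite {1}gE row_PL_step // -gE subrK.
Qed.

End RowmotionInt.

(** The map [lab] is onto but may identify vertices: only the sets of labels in the neighbour lists
    have to agree with the covers. Thus a poset of type B can be labelled by a graph of type A, and
    its rowmotion orbits pull back to symmetric orbits there. *)
Record labelling (d : Order.disp_t) (P : finPOrderType d) (V : eqType)
    (G : cover_graph V) := Labelling {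
  lab : V -> P;
  prk : P -> nat;
  lab_onto : forall p, exists2 v, dom G v & lab v = p;
  lab_rk : forall v, dom G v -> rk G v = prk (lab v);
  up_covers : forall v, dom G v -> forall w,
    covers w (lab v) = (w \in map lab (up G v));
  low_covers : forall v, dom G v -> forall w,
    covers (lab v) w = (w \in map lab (low G v))
}.

Section Labelled.
Context (d : Order.disp_t) (P : finPOrderType d) (V : eqType).
Context (G : cover_graph V) (l : labelling P G).

Lemma prk_covers (x y : P) : covers y x -> prk l y = (prk l x).+1.
Proof.
have [v Dv <-] := lab_onto l x; rewrite (up_covers l Dv) => /mapP[w wv ->].
by rewrite -!lab_rk ?(up_rk Dv wv) // (up_dom Dv wv).
Qed.

Lemma prk_top (x : P) : prk l x <= top G.
Proof. by have [v Dv <-] := lab_onto l x; rewrite -lab_rk // rk_top. Qed.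

Lemma prk_lt (x y : P) : (x < y)%O -> prk l x < prk l y.
Proof.
have [k] := ubnP (top G - prk l x); elim: k x => // k IH x xk xy.
have [z /[dup] zx /prk_covers zr] := cover_above xy.
rewrite le_eqVlt => /orP[/eqP <-|zy]; first by rewrite zr.
have := prk_top z => zt; rewrite ltnW // -zr IH //; lia.
Qed.

Lemma top_vertex : P -> exists2 v, dom G v & rk G v = top G.
Proof.
move=> p; have [v Dv _] := lab_onto l p; move: v Dv.
apply: down_ind => v Dv; case E: (up G v) => [|w s] IH.
  by exists v => //; apply: up_nil.
by apply: (IH w); rewrite mem_head.
Qed.

(** Descending through lower neighbours collects one element per rank and ends at rank 0. *)
Lemma chain_below (x : P) : exists C : {set P},
  [/\ is_chain C, #|C| = (prk l x).+1 & {in C, forall z, (z <= x)%O}].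
Proof.
have [k] := ubnP (prk l x); elim: k x => // k IH x xk.
have [v Dv vx] := lab_onto l x.
case E: (low G v) => [|w s].
  exists [set x]; rewrite cards1; split.
  - apply/forall_inP => y /set1P ->; apply/forall_inP => z /set1P ->.
    exact: comparablexx.
  - by rewrite -vx -lab_rk // (low_nil Dv E).
  - by move=> z /set1P ->.
have wv : w \in low G v by rewrite E mem_head.
have cw : covers x (lab l w) by rewrite -vx (low_covers l Dv) map_f.
have wx : prk l x = (prk l (lab l w)).+1 by apply: prk_covers.
have ltw : (lab l w < x)%O by case/andP: cw.
have [|C [Cc Cn Cl]] := IH (lab l w); first by rewrite -ltnS -wx.
have Clt z : z \in C -> (z < x)%O by move=> /Cl /le_lt_trans; apply.
exists (x |: C); split.
- apply/forall_inP => y /setU1P yC; apply/forall_inP => z /setU1P zC.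
  case: yC => [->|yC]; case: zC => [->|zC].
  + exact: comparablexx.
  + by rewrite comparable_sym lt_comparable ?Clt.
  + by rewrite lt_comparable ?Clt.
  + by have /forall_inP/(_ _ yC)/forall_inP/(_ _ zC) := Cc.
- rewrite cardsU1 Cn -wx; case: (boolP (x \in C)) => // /Clt.
  by rewrite ltxx.
- by move=> z /setU1P[->//|/Clt/ltW].
Qed.

(** The rank [prk] is injective on a chain, which bounds its size by [top] + 1; [chain_below] at a
    vertex of rank [top] attains the bound. The given element of [P] ensures that such a vertex
    exists. *)
Lemma rank_labelled : P -> rank P = top G.
Proof.
move=> p; apply/eqP; rewrite eqn_leq; apply/andP; split.
  apply/bigmax_leqP => C Cc.
  have inj : {in C &, injective (fun x => inord (prk l x) : 'I_(top G).+1)}.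
    move=> x y xC yC /(congr1 val); rewrite /= !inordK ?ltnS ?prk_top // => e.
    have /forall_inP/(_ _ xC)/forall_inP/(_ _ yC) := Cc.
    by case: (comparableP x y) => // /prk_lt; rewrite e ltnn.
  have := max_card [set (inord (prk l x) : 'I_(top G).+1) | x in C].
  by rewrite card_in_imset // card_ord; case: #|C|.
have [v Dv vt] := top_vertex p; have [C [Cc Cn _]] := chain_below (lab l v).
rewrite -vt (lab_rk l Dv) -[prk l _]/(prk l _).+1.-1 -Cn.
exact: (@leq_bigmax_cond _ (fun C : {set P} => is_chain C)).
Qed.

Lemma hnum_labelled : P -> hnum P = (top G).+2.
Proof. by move=> p; rewrite /hnum rank_labelled // addn2. Qed.

Context (R : realType) (ell : nat) (ell_gt0 : 0 < ell) (s : seq P).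
Context (sle : linear_extension s).

Definition pp_int (T : PP P ell) (v : V) : int := (val T (lab l v))%:Z.

Lemma pp_int_inj (T U : PP P ell) : {in dom G, pp_int T =1 pp_int U} -> T = U.
Proof.
move=> TU; apply: val_inj; apply/ffunP => p; apply: ord_inj.
by have [v Dv <-] := lab_onto l p; have [] := TU v Dv.
Qed.

Lemma rowmotion_PLstep (T : PP P ell) :
  PLstep G ell%:Z (pp_int T) (pp_int (rowmotion R s T)).
Proof.
move=> v Dv; set U := rowmotion R s T.
have [x [y [xp py xmin ymax E]]] := rowmotion_int_step R ell_gt0 T (lab l v) sle.
rewrite [LHS]E; congr (_ + _)%R; apply/esym.
  case: x xp xmin {E} => [|w|] //.
    rewrite covers_HatIn (up_covers l Dv) => wu wmin; apply: minlE.
      by move/mapP: wu => [w' w'v ->]; rewrite (map_f (pp_int U)).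
    move=> _ /mapP[w' w'v ->]; apply: (wmin (HatIn (lab l w'))).
    by rewrite covers_HatIn (up_covers l Dv) map_f.
  rewrite covers_Hat1 => /forallP nc _; case E: (up G v) => [|w r] //.
  by have := nc (lab l w); rewrite (up_covers l Dv) E /= inE eqxx.
case: y py ymax {E} => [|w|] //.
  rewrite covers_Hat0 => /forallP nc _; case E: (low G v) => [|w r] //.
  by have := nc (lab l w); rewrite (low_covers l Dv) E /= inE eqxx.
rewrite covers_HatIn (low_covers l Dv) => wu wmin; apply: maxlE.
  by move/mapP: wu => [w' w'v ->]; rewrite (map_f (pp_int T)).
move=> _ /mapP[w' w'v ->]; apply: (wmin (HatIn (lab l w'))).
by rewrite covers_HatIn (low_covers l Dv) map_f.
Qed.

Local Notation row := (rowmotion_perm R ell s).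

Definition row_orbit (T : PP P ell) (t : nat) : V -> int := pp_int ((row ^+ t)%g T).

Lemma row_orbit_step T t : PLstep G ell%:Z (row_orbit T t) (row_orbit T t.+1).
Proof. by rewrite /row_orbit expgSr permM permE; apply: rowmotion_PLstep. Qed.

Lemma row_orbitD T t u : row_orbit T (t + u) = row_orbit ((row ^+ t)%g T) u.
Proof. by rewrite /row_orbit expgD permM. Qed.

Definition pp_zero : PP P ell.
Proof.
exists [ffun=> ord0]; apply/forallP => x; apply/forallP => y.
by rewrite !ffunE implybT.
Defined.

(** The first step raises all values to [ell]; each later step returns one more rank, from the
    bottom up, to 0. *)
Lemma row_orbit_zero t : t <= (top G).+2 -> {in dom G, row_orbit pp_zero t =1
  fun v => if 0 < t <= (rk G v).+1 then (ell%:Z)%R else 0%R}.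
Proof.
elim: t => [|t IH] tt v Dv; first by rewrite /row_orbit expg0 perm1 /pp_int ffunE.
(* By [PLstep_inj] it suffices that this closed formula satisfies the recurrence. *)
pose F u (v : V) := if 0 < u <= (rk G v).+1 then (ell%:Z)%R else 0%R.
apply: (PLstep_inj (row_orbit_step pp_zero t) _ (IH (ltnW tt)) Dv (g' := F t.+1)).
move=> {Dv}v Dv; rewrite /F /=.
rewrite (@minl_const _ _ (if t <= (rk G v).+1 then (ell%:Z)%R else 0%R)); first last.
- by move=> /(up_nil Dv) ->; rewrite -ltnS tt.
- by move=> w /(up_rk Dv) ->; rewrite ltnS.
rewrite (@maxl_const _ _ (if 0 < t <= rk G v then (ell%:Z)%R else 0%R)); first last.
- by move=> /(low_nil Dv) ->; case: (t).
- by move=> w /(low_rk Dv) ->.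
rewrite ltnS; case: t {IH tt} => [|t] //=; rewrite ltnS.
case: ltnP => tr; first by rewrite (ltnW tr).
by case: leqP => _; rewrite ?addr0 ?add0r.
Qed.

(** The zero map recurs at time [top] + 2 and at no earlier positive time, because until then a
    vertex of rank [top] has the value [ell]. *)
Lemma dvdn_order : P -> (top G).+2 %| #[row]%g.
Proof.
move=> p; have [v Dv vt] := top_vertex p.
have h0 : ((row ^+ (top G).+2)%g pp_zero) = pp_zero.
  apply: pp_int_inj => w Dw; rewrite -[LHS]/(row_orbit _ _ _) row_orbit_zero //.
  by have := rk_top Dw; case: ifP => [/andP[_]|_ _]; [lia|rewrite /pp_int ffunE].
set N := #[row]%g; set h := (top G).+2.
have hm m : ((row ^+ (m * h))%g pp_zero) = pp_zero.
  by elim: m => [|m IH]; rewrite ?mul0n ?expg0 ?perm1 // mulSn expgD permM h0.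
(* Reducing the order modulo [h] leaves a time smaller than [h] at which the zero map recurs, so
   this time is 0. *)
have : ((row ^+ (N %% h))%g pp_zero) = pp_zero.
  have : ((row ^+ N)%g pp_zero) = pp_zero by rewrite expg_order perm1.
  by rewrite {1}(divn_eq N h) expgD permM hm.
have lth : N %% h < h by rewrite ltn_mod.
rewrite /dvdn; case: (posnP (N %% h)) => [->//|m0].
move/(congr1 (fun T => pp_int T v)); rewrite -[LHS]/(row_orbit _ _ _).
rewrite (row_orbit_zero (ltnW lth) Dv) m0 vt -ltnS lth /pp_int ffunE /= => -[e].
by move: ell_gt0; rewrite e.
Qed.

Lemma order_dvdn_period N : (forall T, {in dom G, row_orbit T N =1 row_orbit T 0}) ->
  #[row]%g %| N.
Proof.
move=> H; rewrite order_dvdn; apply/eqP/permP => T; rewrite perm1.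
by apply: pp_int_inj => v /(H T); rewrite /row_orbit expg0 perm1.
Qed.

Lemma order_period :
  P -> (forall T, {in dom G, row_orbit T (top G).+2 =1 row_orbit T 0}) ->
  #[row]%g = hnum P.
Proof.
move=> p H; rewrite hnum_labelled //; apply/eqP.
by rewrite eqn_dvd dvdn_order // order_dvdn_period.
Qed.

(** The order is a multiple of [top] + 2 and divides twice that number, so a single labelling not
    fixed after [top] + 2 steps decides. *)
Lemma order_double_period :
  (forall T, {in dom G, row_orbit T (2 * (top G).+2) =1 row_orbit T 0}) ->
  (exists T v, row_orbit T (top G).+2 v <> row_orbit T 0 v) ->
  #[row]%g = 2 * hnum P.
Proof.
move=> H [T [v nT]].
have p := lab l v; rewrite hnum_labelled //; set h := (top G).+2.
have /dvdnP[c oc] := dvdn_order p.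
have := order_dvdn_period H; rewrite oc -/h dvdn_pmul2r //.
have c1 : c != 1.
  apply/eqP => c1; apply: nT; rewrite /row_orbit -/h -[h]mul1n -c1 -oc.
  by rewrite expg_order expg0.
by case: c c1 {oc} => [|[|[|c]]].
Qed.

Definition nrow_orbit T t : V -> int := normalize G ell%:Z (row_orbit T t).

Lemma nrow_orbit_step T t : PLstep G 0%R (nrow_orbit T t) (nrow_orbit T t.+1).
Proof. exact/normalize_step/row_orbit_step. Qed.

End Labelled.

(** * Birational steps and tropicalization *)

(** After normalization the added bottom and top have the value 0, hence the birational value 1. *)
Definition sum1 (F : pzRingType) (s : seq F) : F := fold1 +%R 1%R s.

Section Birational.
Context (F : realFieldType) (V : eqType) (G : cover_graph V).
Local Open Scope ring_scope.
Implicit Types (x y : V -> F) (v w : V).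

Lemma sum1_gt0 (s : seq F) : (forall a, a \in s -> 0 < a) -> 0 < sum1 s.
Proof.
case: s => [|b s] sP; first by rewrite ltr01.
rewrite /sum1 /=; have b0 : 0 < b by rewrite sP ?mem_head.
have {sP} : forall a, a \in s -> 0 < a by move=> a sa; rewrite sP // inE sa orbT.
elim: s => //= c s IH sP; apply: addr_gt0; first by rewrite sP ?mem_head.
by apply: IH => a sa; rewrite sP // inE sa orbT.
Qed.

Definition posfun x : Prop := forall v, 0 < x v.

(** Max becomes a sum and min the reciprocal of a sum of reciprocals; this last denominator has been
    cleared. *)
Definition BRstep x y : Prop := forall v, dom G v ->
  y v * x v * sum1 [seq (y w)^-1 | w <- up G v] = sum1 [seq x w | w <- low G v].

Lemma sum1_map_gt0 x (s : seq V) : posfun x -> 0 < sum1 (map x s).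
Proof. by move=> x0; apply: sum1_gt0 => _ /mapP[w _ ->]. Qed.

Lemma sum1_inv_gt0 x (s : seq V) : posfun x -> 0 < sum1 [seq (x w)^-1 | w <- s].
Proof. by move=> x0; apply: sum1_gt0 => _ /mapP[w _ ->]; rewrite invr_gt0. Qed.

Lemma BRstep_inj x x' y y' : posfun x -> posfun y ->
  BRstep x y -> BRstep x' y' -> {in dom G, x =1 x'} -> {in dom G, y =1 y'}.
Proof.
move=> x0 y0 xy xy' xx' v; move: v; apply: down_ind => v Dv IH.
have D0 := sum1_inv_gt0 (up G v) y0.
have DE : [seq (y w)^-1 | w <- up G v] = [seq (y' w)^-1 | w <- up G v].
  by apply/eq_in_map => w /IH ->.
have D1 : sum1 [seq (y w)^-1 | w <- up G v] != 0 by rewrite gt_eqF.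
have x1 : x v != 0 by rewrite gt_eqF.
apply: (mulIf x1); apply: (mulIf D1); rewrite xy // DE xx' // xy' //.
by congr sum1; apply/eq_in_map => w wv; rewrite xx' //; apply: low_dom wv.
Qed.

Definition BRmap x y v : F :=
  sum1 [seq x w | w <- low G v] / (x v * sum1 [seq (y w)^-1 | w <- up G v]).

(** The step is implicit in the new values above a vertex. Iterating [BRmap x] once per rank makes
    the values correct from the top downwards, whatever the starting function. *)
Definition BRnext x : V -> F := iter (top G).+1 (BRmap x) x.

Lemma BRmap_gt0 x y : posfun x -> posfun y -> posfun (BRmap x y).
Proof.
move=> x0 y0 v; rewrite divr_gt0 ?sum1_map_gt0 //.
by rewrite mulr_gt0 // sum1_inv_gt0.
Qed.

Lemma BRnext_gt0 x : posfun x -> posfun (BRnext x).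
Proof.
by move=> x0; rewrite /BRnext; elim: _.+1 => // k IH; apply: BRmap_gt0.
Qed.

Lemma BRnextE x v : dom G v -> BRnext x v = BRmap x (BRnext x) v.
Proof.
(* After [k] iterations the values at ranks greater than [top] - k are final. *)
suff H k : (top G < k + rk G v)%N -> dom G v ->
    iter k (BRmap x) x v = BRmap x (iter k (BRmap x) x) v by apply: H; lia.
elim: k v => [|k IH] v lt Dv; first by have := rk_top Dv; lia.
rewrite /= {1}/BRmap [RHS]/BRmap; congr (_ / (_ * sum1 _)).
apply/eq_in_map => w wv; rewrite [in LHS]IH ?(up_dom Dv wv) //.
by rewrite (up_rk Dv wv); lia.
Qed.

Lemma BRnext_step x : posfun x -> BRstep x (BRnext x).
Proof.
move=> x0 v Dv; rewrite -mulrA [BRnext x v in LHS]BRnextE // /BRmap divfK //.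
by rewrite mulf_neq0 // gt_eqF // sum1_inv_gt0 //; apply: BRnext_gt0.
Qed.

End Birational.

(** * Growth exponents of positive functions *)

Section Asymptotics.
Context (F : realFieldType).
Local Open Scope ring_scope.
Implicit Types (x y : F -> F) (a b : int).

(** Growth of exact order z ^ a, with one constant for both bounds. The lower bound forces
    positivity, so nothing cancels in a sum and its exponent is the maximum of the exponents. *)
Definition asymp x a : Prop := exists2 C : F, 0 < C &
  forall z, 1 <= z -> z ^ a <= C * x z /\ x z <= C * z ^ a.

Lemma eq_asymp x y a : (forall z, 1 <= z -> x z = y z) -> asymp x a -> asymp y a.
Proof. by move=> xy [C C0 H]; exists C => // z z1; rewrite -xy //; apply: H. Qed.

Lemma asymp_exp a : asymp (fun z => z ^ a) a.
Proof. by exists 1 => // z z1; rewrite mul1r. Qed.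

Lemma asymp1 : asymp (fun=> 1) 0.
Proof. exact: (asymp_exp 0). Qed.

Lemma exprz_ge1_gt0 (z : F) a : 1 <= z -> 0 < z ^ a.
Proof. by move=> z1; rewrite exprz_gt0 // (lt_le_trans ltr01). Qed.

Lemma asymp_gt0 x a z : asymp x a -> 1 <= z -> 0 < x z.
Proof.
case=> C C0 H z1; have [+ _] := H z z1 => /(lt_le_trans (exprz_ge1_gt0 a z1)).
by rewrite pmulr_rgt0.
Qed.

Lemma asympM x y a b : asymp x a -> asymp y b -> asymp (fun z => x z * y z) (a + b).
Proof.
move=> xa yb; have [C C0 Hx] := xa; have [D D0 Hy] := yb.
exists (C * D); first by rewrite mulr_gt0.
move=> z z1; have [x1 x2] := Hx z z1; have [y1 y2] := Hy z z1.
have z0 : z != 0 by rewrite gt_eqF // (lt_le_trans ltr01).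
rewrite expfzDr // !(mulrACA C D); split; apply: ler_pM => //.
all: by rewrite ltW // ?exprz_ge1_gt0 // (asymp_gt0 xa, asymp_gt0 yb).
Qed.

Lemma asympV x a : asymp x a -> asymp (fun z => (x z)^-1) (- a).
Proof.
move=> xa; have [C C0 H] := xa; exists C => // z z1; have [x1 x2] := H z z1.
have x0 := asymp_gt0 xa z1; have z0 := exprz_ge1_gt0 a z1.
rewrite -invr_expz; split.
  by rewrite ler_pdivlMr // mulrC ler_pdivrMr // mulrC.
by rewrite ler_pdivlMr // mulrC ler_pdivrMr // mulrC.
Qed.

Lemma asympD x y a b :
  asymp x a -> asymp y b -> asymp (fun z => x z + y z) (Num.max a b).
Proof.
move=> xa yb; have [C C0 Hx] := xa; have [D D0 Hy] := yb.
exists (C + D); first by rewrite addr_gt0.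
move=> z z1; have [x1 x2] := Hx z z1; have [y1 y2] := Hy z z1.
have x0 := ltW (asymp_gt0 xa z1); have y0 := ltW (asymp_gt0 yb z1).
split.
  case: (leP a b) => _.
    by apply: (le_trans y1); apply: ler_pM; rewrite ?lerDr ?lerDl // ltW.
  by apply: (le_trans x1); apply: ler_pM; rewrite ?lerDr ?lerDl // ltW.
rewrite mulrDl lerD //.
  by apply: (le_trans x2); rewrite ler_pM2l // ler_weXz2l // le_max lexx.
by apply: (le_trans y2); rewrite ler_pM2l // ler_weXz2l // le_max lexx orbT.
Qed.

Lemma asymp_le x a b : asymp x a -> asymp x b -> a <= b.
Proof.
move=> [C C0 H] [D D0 K]; rewrite leNgt; apply/negP => ab.
(* At this point the bounds would give z <= z ^ (a - b) <= C * D < z. *)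
pose z := C * D + 1.
have z1 : 1 <= z by rewrite lerDr mulr_ge0 // ltW.
have [h _] := H z z1; have [_ k] := K z z1.
have z0 : z != 0 by rewrite gt_eqF // (lt_le_trans ltr01).
have : z ^ (a - b) <= C * D.
  rewrite expfzDr // -invr_expz ler_pdivrMr ?exprz_ge1_gt0 //.
  by apply: (le_trans h); rewrite -mulrA ler_pM2l.
apply/negP; rewrite -ltNge; apply: (@lt_le_trans _ _ z); first by rewrite ltrDl.
by rewrite -[X in X <= _]expr1z ler_weXz2l //; lia.
Qed.

Lemma asymp_inj x a b : asymp x a -> asymp x b -> a = b.
Proof. by move=> xa xb; apply/le_anti; rewrite !(asymp_le (x := x)). Qed.

Lemma asymp_sum1 (T : eqType) (s : seq T) (x : F -> T -> F) (f : T -> int) :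
  (forall u, u \in s -> asymp (x^~ u) (f u)) ->
  asymp (fun z => sum1 (map (x z) s)) (maxl 0 (map f s)).
Proof.
case: s => [|u s] H; first exact: asymp1.
rewrite /sum1 /maxl /=; have Hu : asymp (x^~ u) (f u) by apply: H; rewrite mem_head.
have {H} : forall v, v \in s -> asymp (x^~ v) (f v).
  by move=> v vs; apply: H; rewrite inE vs orbT.
elim: s => //= v s IH H; apply: asympD; first by apply: H; rewrite mem_head.
by apply: IH => w ws; apply: H; rewrite inE ws orbT.
Qed.

End Asymptotics.

Section Tropicalization.
Context (F : realFieldType) (V : eqType) (G : cover_graph V).
Local Open Scope ring_scope.

Definition BRorbit (x : nat -> V -> F) : Prop :=
  (forall t, posfun (x t)) /\ (forall t, BRstep G (x t) (x t.+1)).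

(** Start from the monomials z ^ (f 0 v) and iterate the birational step: products add exponents and
    sums take their maximum, so the exponents follow the piecewise-linear recurrence. *)
Lemma tropicalization (f : nat -> V -> int) :
  (forall t, PLstep G 0 (f t) (f t.+1)) ->
  exists X : F -> nat -> V -> F,
    (forall z, 1 <= z -> BRorbit (X z)) /\
    (forall t v, dom G v -> asymp (fun z => X z t v) (f t v)).
Proof.
move=> fs; pose X z t := iter t (BRnext G) (fun v => z ^ (f 0%N v)) : V -> F.
have X0 z t : 1 <= z -> posfun (X z t).
  move=> z1; elim: t => [|t IH]; first by move=> v; apply: exprz_ge1_gt0.
  exact: BRnext_gt0.
exists X; split=> [z z1|t v].
  by split=> t; [exact: X0|apply: BRnext_step; apply: X0].
elim: t v => [|t IH] v; first by move=> _; apply: asymp_exp.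
move: v; apply: down_ind => v Dv IHv.
(* The minimum is written as a negated maximum of opposites, which is how the exponent of a sum of
   reciprocals appears. *)
have -> : f t.+1 v = maxl 0 (map (f t) (low G v)) +
    - (f t v + maxl 0 (map (fun w => - f t.+1 w) (up G v))).
  have -> : maxl 0 [seq - f t.+1 w | w <- up G v] = - minl 0 (map (f t.+1) (up G v)).
    by rewrite maxl_opp oppr0 -map_comp; congr (- minl _ _); apply: eq_map => w /=; rewrite opprK.
  by have := fs t v Dv; lia.
apply: (eq_asymp (x := fun z => BRmap G (X z t) (X z t.+1) v)).
  by move=> z z1; rewrite /X /= -BRnextE.
apply: asympM; first by apply: asymp_sum1 => w wv; apply: IH; apply: low_dom wv.
apply/asympV/asympM; first exact: IH.
by apply: (asymp_sum1 (x := fun z w => (X z t.+1 w)^-1)) => w /IHv; apply: asympV.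
Qed.

End Tropicalization.

(** * Reciprocity on the square *)

Section SquareGraph.
Context (N : nat).

Definition sq_dom (v : nat * nat) : bool := (0 < v.1 <= N) && (0 < v.2 <= N).

Definition sq_up (v : nat * nat) : seq (nat * nat) :=
  (if v.1 < N then [:: (v.1.+1, v.2)] else [::]) ++
  (if v.2 < N then [:: (v.1, v.2.+1)] else [::]).

Definition sq_low (v : nat * nat) : seq (nat * nat) :=
  (if 1 < v.1 then [:: (v.1.-1, v.2)] else [::]) ++
  (if 1 < v.2 then [:: (v.1, v.2.-1)] else [::]).

Definition sq_rk (v : nat * nat) : nat := v.1 + v.2 - 2.

Lemma sq_up_prop v w : sq_dom v -> w \in sq_up v ->
  sq_dom w && (sq_rk w == (sq_rk v).+1).
Proof.
case: v => i j; rewrite /sq_dom /sq_up /sq_rk /= => ij.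
by case: ltnP => iN; case: ltnP => jN; rewrite ?inE //=; try case/orP;
  move/eqP => -> /=; lia.
Qed.

Lemma sq_low_prop v w : sq_dom v -> w \in sq_low v ->
  sq_dom w && (sq_rk v == (sq_rk w).+1).
Proof.
case: v => i j; rewrite /sq_dom /sq_low /sq_rk /= => ij.
by case: ltnP => iN; case: ltnP => jN; rewrite ?inE //=; try case/orP;
  move/eqP => -> /=; lia.
Qed.

Definition square : cover_graph (nat * nat)%type.
Proof.
refine (@CoverGraph _ sq_dom sq_up sq_low sq_rk (N + N - 2) _ _ _ _ _ _ _).
- by move=> v w Dv /(sq_up_prop Dv)/andP[].
- by move=> v w Dv /(sq_low_prop Dv)/andP[].
- by move=> v w Dv /(sq_up_prop Dv)/andP[_ /eqP].
- by move=> v w Dv /(sq_low_prop Dv)/andP[_ /eqP].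
- case=> i j; rewrite /sq_dom /sq_up /sq_rk /= => ij.
  by case: ltnP => iN; case: ltnP => jN //= _; lia.
- case=> i j; rewrite /sq_dom /sq_low /sq_rk /= => ij.
  by case: ltnP => iN; case: ltnP => jN //= _; lia.
- by case=> i j; rewrite /sq_dom /sq_rk /=; lia.
Defined.

End SquareGraph.

(** * Weighted lattice paths in the square *)

Section PathSums.
Context (F : realFieldType) (N : nat).
Local Open Scope ring_scope.
Implicit Types (x : nat * nat -> F) (w : nat -> nat -> F).

(* The sum over the lattice paths from (i, 0) to (a, b) whose first step goes to
   (i, 1) of the product of the weights of the vertices other than (i, 0). *)
Fixpoint pathsum w (i b : nat) : nat -> F :=
  if b is b'.+1 then
    fix col a := if a is a'.+1 then w a b * (col a' + pathsum w i b' a) else 0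
  else fun a => (a == i)%:R.

Lemma pathsumS w i b a : pathsum w i b.+1 a.+1 =
  w a.+1 b.+1 * (pathsum w i b.+1 a + pathsum w i b a.+1).
Proof. by []. Qed.

Lemma pathsum0 w i b : pathsum w i b.+1 0 = 0.
Proof. by []. Qed.

Definition lowsum x v : F := sum1 (map x (sq_low v)).
Definition upsum x v : F := sum1 [seq (x u)^-1 | u <- sq_up N v].

Lemma lowsumE x a b : lowsum x (a.+2, b.+2) = x (a.+2, b.+1) + x (a.+1, b.+2).
Proof. by []. Qed.

Lemma lowsum_bottom x a : lowsum x (a.+2, 1%N) = x (a.+1, 1%N).
Proof. by []. Qed.

Lemma lowsum_left x b : lowsum x (1%N, b.+2) = x (1%N, b.+1).
Proof. by []. Qed.

Lemma lowsum_corner x : lowsum x (1%N, 1%N) = 1.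
Proof. by []. Qed.

Lemma upsumE x a b : (a < N)%N -> (b < N)%N ->
  upsum x (a, b) = (x (a, b.+1))^-1 + (x (a.+1, b))^-1.
Proof. by rewrite /upsum /sq_up /= => -> ->. Qed.

Lemma upsum_top x a : (a < N)%N -> upsum x (a, N) = (x (a.+1, N))^-1.
Proof. by rewrite /upsum /sq_up /= ltnn => ->. Qed.

Lemma upsum_right x b : (b < N)%N -> upsum x (N, b) = (x (N, b.+1))^-1.
Proof. by rewrite /upsum /sq_up /= ltnn => ->. Qed.

Lemma upsum_corner x : upsum x (N, N) = 1.
Proof. by rewrite /upsum /sq_up /= ltnn. Qed.

(* With eta := h / x, the defining equation of h says that eta is a weighted
   average of its lower neighbours, and g turns out to be its discrete
   harmonic conjugate. *)
Section Conversion.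
Context (x : nat * nat -> F) (x_gt0 : posfun x) (i : nat) (iN : (i < N)%N).

Let A a b := x (a, b) / lowsum x (a, b).
Let V a b := (x (a, b) * upsum x (a, b))^-1.
Let h b a := pathsum A i.+2 b a.
Let g b a := pathsum V i.+1 b a.
Let eta a b := h b a / x (a, b).

Let x_neq0 v : x v != 0. Proof. by rewrite gt_eqF. Qed.

Let lowsum_neq0 v : lowsum x v != 0.
Proof. by rewrite gt_eqF // sum1_map_gt0. Qed.

Let upsum_neq0 v : upsum x v != 0.
Proof. by rewrite gt_eqF // sum1_inv_gt0. Qed.

Let gE a b : g b.+1 a.+1 * (x (a.+1, b.+1) * upsum x (a.+1, b.+1)) =
  g b.+1 a + g b a.+1.
Proof. by rewrite /g pathsumS mulrAC mulVf ?mul1r // mulf_neq0. Qed.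

Let eta_low a b : eta a.+1 b.+1 * lowsum x (a.+1, b.+1) = h b.+1 a + h b a.+1.
Proof.
rewrite /eta /h pathsumS /A; field.
by rewrite x_neq0 lowsum_neq0.
Qed.

Let hE a b : h b a = x (a, b) * eta a b.
Proof. by rewrite /eta mulrC divfK. Qed.

Let eta_left b : eta 1 b.+1 = 0.
Proof.
elim: b => [|b IH].
  by have := eta_low 0 0; rewrite lowsum_corner mulr1 => ->; rewrite /h pathsum0 addr0.
have := eta_low 0 b.+1; rewrite lowsum_left /h pathsum0 -/(h b.+1 1%N) hE IH mulr0.
by rewrite addr0 => /eqP; rewrite mulf_eq0 (negPf (x_neq0 _)) orbF => /eqP.
Qed.

Let eta_bottom a : x (a.+1, 1%N) * (eta a.+2 1 - eta a.+1 1) = (a == i)%:R.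
Proof.
have := eta_low a.+1 0; rewrite lowsum_bottom hE mulrC /h /= !eqSS => E.
by rewrite mulrBr E addrAC subrr add0r.
Qed.

Let harm a b : eta a.+2 b.+2 * (x (a.+2, b.+1) + x (a.+1, b.+2)) =
  x (a.+1, b.+2) * eta a.+1 b.+2 + x (a.+2, b.+1) * eta a.+2 b.+1.
Proof. by rewrite -lowsumE eta_low !hE. Qed.

(** By [harm], the increments of [eta] along the two edges into a vertex, weighted by [x] at their
    starting points, are opposite; hence this form of [g] and that of [conj_right] agree. In the
    recurrence of [g] the two increments leaving a vertex telescope, and [harm] closes the double
    induction. *)
Let conj_up a b : (a.+1 < N)%N -> (b < N)%N ->
  g b a.+1 = x (a.+1, b.+1) * (eta a.+2 b.+1 - eta a.+1 b.+1).
Proof.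
elim: b a => [|b IHb] a; first by rewrite eta_bottom /g /= eqSS.
have conj_right a' : (a'.+1 < N)%N -> (b.+1 < N)%N ->
    g b.+1 a'.+1 = x (a'.+1, b.+2) * (eta a'.+2 b.+2 - eta a'.+1 b.+2) ->
    g b.+1 a'.+1 = x (a'.+2, b.+1) * (eta a'.+2 b.+1 - eta a'.+2 b.+2).
  by move=> _ _ ->; have := harm a' b => H; lra.
elim: a => [|a IHa] aN bN.
  have := gE 0 b; rewrite /g pathsum0 -/(g b.+1 1%N) -/(g b 1%N) add0r.
  rewrite (IHb 0%N aN (ltnW bN)) (upsumE _ aN bN) eta_left subr0 => E.
  have H := harm 0 b; rewrite eta_left mulr0 add0r in H.
  have n0 : (x (1%N, b.+2))^-1 + (x (2, b.+1))^-1 != 0.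
    by rewrite -(upsumE _ aN bN) upsum_neq0.
  apply: (mulIf (mulf_neq0 (x_neq0 (1%N, b.+1)) n0)); rewrite E eta_left subr0.
  apply: (mulfI (x_neq0 (2, b.+1))).
  have -> : eta 2 b.+1 = eta 2 b.+2 * (x (2, b.+1) + x (1%N, b.+2)) / x (2, b.+1).
    by rewrite H mulrC mulKf.
  by field; rewrite !x_neq0.
have := gE a.+1 b.
rewrite (conj_right a (ltnW aN) bN (IHa (ltnW aN) bN)) (IHb a.+1 aN (ltnW bN)).
rewrite (upsumE _ aN bN) => E.
have n0 : (x (a.+2, b.+2))^-1 + (x (a.+3, b.+1))^-1 != 0.
  by rewrite -(upsumE _ aN bN) upsum_neq0.
apply: (mulIf (mulf_neq0 (x_neq0 (a.+2, b.+1)) n0)); rewrite E.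
have -> : eta a.+3 b.+1 = (eta a.+3 b.+2 * (x (a.+3, b.+1) + x (a.+2, b.+2)) -
    x (a.+2, b.+2) * eta a.+2 b.+2) / x (a.+3, b.+1).
  by rewrite harm addrAC subrr add0r mulrC mulKf.
by field; rewrite !x_neq0.
Qed.

Let conj_right a b : (a < N)%N -> (b.+1 < N)%N ->
  g b.+1 a = x (a.+1, b.+1) * (eta a.+1 b.+1 - eta a.+1 b.+2).
Proof.
case: a => [|a] aN bN; first by rewrite !eta_left subrr mulr0 /g pathsum0.
by rewrite conj_up //; have := harm a b => H; lra.
Qed.

(** On the top row the upper sum has a single term, and with [conj_up] the recurrence of [g]
    telescopes to the next value of [h]. *)
Lemma pathsum_shift a : (a < N)%N -> pathsum V i.+1 N a = pathsum A i.+2 N a.+1.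
Proof.
move=> aN; rewrite -/(g N a) -/(h N a.+1).
case: N aN iN (@conj_up) gE (@upsum_top x) => // M aM _ cu gE' ut.
elim: a aM => [|a IH] aM; first by rewrite hE eta_left mulr0 /g pathsum0.
have := gE' a M; rewrite ut // (IH (ltnW aM)) (cu a M) // !hE => E.
apply: (mulIf (mulf_neq0 (x_neq0 (a.+1, M.+1)) (invr_neq0 (x_neq0 (a.+2, M.+1))))).
by rewrite E; field; rewrite x_neq0.
Qed.

(** On the right edge the formula of [conj_up] persists if [eta] is continued to a column N + 1 by
    the constant [c]. At the corner, where the upper sum is 1, the values of [eta] cancel and only
    [c] remains. *)
Lemma pathsum_exit : pathsum V i.+1 N N = (x (i.+1, 1%N))^-1.
Proof.
rewrite -/(g N N); pose c := (x (i.+1, 1%N))^-1; pose M := N.-1.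
have EN : M.+1 = N by rewrite prednK // (leq_ltn_trans _ iN).
(* Along the bottom row [eta] jumps only once, from 0 at column i + 1 to [c] at column i + 2. *)
have etaM a : (a < N)%N -> eta a.+1 1 = if (i < a)%N then c else 0.
  elim: a => [|a IH] aM; first by rewrite eta_left.
  have := eta_bottom a; rewrite (IH (ltnW aM)) ltnS [in X in _ -> X]leq_eqVlt eq_sym.
  have [<-|ai] /= := eqVneq i a.
    rewrite ltnn subr0 => E; apply: (mulfI (x_neq0 (i.+1, 1%N))).
    by rewrite E /c mulfV.
  by move/eqP; rewrite mulf_eq0 (negPf (x_neq0 _)) subr_eq0 => /eqP.
have MN : (M < N)%N by rewrite -EN.
have etaN : eta N 1 = if (i < M)%N then c else 0 by rewrite -etaM // EN.
have right b : (b < N)%N -> g b N = x (N, b.+1) * (c - eta N b.+1).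
  elim: b => [|b IH] bM.
    rewrite etaN /g /= -EN eqSS; have [->|Mi] := eqVneq M i.
      by rewrite ltnn subr0 /c mulfV.
    by rewrite ifT ?subrr ?mulr0 // ltn_neqAle eq_sym Mi -ltnS EN.
  have := gE M b; have := conj_right MN bM.
  rewrite EN (upsum_right _ bM) (IH (ltnW bM)) => -> E.
  apply: (mulIf (mulf_neq0 (x_neq0 (N, b.+1)) (invr_neq0 (x_neq0 (N, b.+2))))).
  by rewrite E; field; rewrite x_neq0.
have ps : g N M = h N M.+1 := pathsum_shift MN.
have := gE M M; rewrite EN upsum_corner mulr1 (right M MN) ps hE EN => E.
by apply: (mulIf (x_neq0 (N, N))); rewrite E /c; ring.
Qed.

End Conversion.
End PathSums.

Section SquareReciprocity.
Context (F : realFieldType) (N : nat) (x : nat -> nat * nat -> F).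
Context (x_orb : BRorbit (square N) x).
Local Open Scope ring_scope.

Let x_gt0 t : posfun (x t). Proof. by case: x_orb. Qed.

Let x_neq0 t v : x t v != 0. Proof. by rewrite gt_eqF // x_gt0. Qed.

Let slack t a b : F := x t (a, b) / lowsum (x t) (a, b).

(** The orbit equation identifies the weights [A] of [Conversion] at time t with its weights [V] at
    time t + 1; this couples the path sums at consecutive times. *)
Let slackE t a b : sq_dom N (a, b) ->
  slack t a b = (x t.+1 (a, b) * upsum N (x t.+1) (a, b))^-1.
Proof.
move=> ab; have E := x_orb.2 t _ ab; rewrite /slack /lowsum.
by rewrite -[sum1 (map _ _)]E mulrAC invfM mulrCA mulfV ?mulr1.
Qed.

Lemma eq_pathsum (w w' : nat -> nat -> F) i b a :
  (forall a b, sq_dom N (a, b) -> w a b = w' a b) -> (a <= N)%N -> (b <= N)%N ->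
  pathsum w i b a = pathsum w' i b a.
Proof.
move=> ww'; elim: b a => [//|b IHb]; elim=> [//|a IHa] aN bN.
by rewrite !pathsumS (IHa (ltnW aN) bN) (IHb _ aN (ltnW bN)) ww' // /sq_dom /= aN bN.
Qed.

Let E t i a := pathsum (slack t) i N a.

(** With source (1, 0), the labelling [x t] itself solves the recurrence of the path sums. *)
Let E_source t a : (0 < a <= N)%N -> E t 1 a = x t (a, N).
Proof.
move=> /andP[a0 aN]; rewrite /E.
suff H b c : (b < N)%N -> (c < N)%N ->
    pathsum (slack t) 1 b.+1 c.+1 = x t (c.+1, b.+1).
  case: a N a0 aN H => [|a] [|M] // _ aM H; exact: H.
elim: b c => [|b IHb] c bN; elim: c => [|c IHc] cN; rewrite pathsumS /slack.
- by rewrite pathsum0 lowsum_corner /= add0r divr1 mulr1.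
- by rewrite (IHc (ltnW cN)) lowsum_bottom /= addr0 divfK.
- by rewrite (IHb _ (ltnW bN) cN) pathsum0 add0r lowsum_left divfK.
rewrite (IHb _ (ltnW bN) cN) (IHc (ltnW cN)) lowsumE [x t (c.+1, _) + _]addrC divfK //.
by rewrite gt_eqF // addr_gt0 ?x_gt0.
Qed.

Let E_shift t i a : (i < N)%N -> (a < N)%N -> E t i.+1 a = E t.+1 i.+2 a.+1.
Proof.
move=> iN aN; rewrite /E -(pathsum_shift (x_gt0 t.+1)) //.
by apply: eq_pathsum => [c b|//|//]; [exact: slackE|exact: ltnW].
Qed.

Let E_exit t i : (i < N)%N -> E t i.+1 N = (x t.+1 (i.+1, 1%N))^-1.
Proof.
move=> iN; rewrite /E -(pathsum_exit (x_gt0 t.+1) iN).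
by apply: eq_pathsum => // c b; exact: slackE.
Qed.

(** Enter at the top edge with [E_source], shift i - 1 times, and leave at the corner (N, N) with
    [E_exit]. *)
Lemma edge_reciprocity t i : (0 < i <= N)%N ->
  x (t + i) (i, 1%N) * x t (N.+1 - i, N)%N = 1.
Proof.
move=> /andP[i0 iN].
have H k a : (a + k <= N)%N -> (0 < a)%N -> E t 1 a = E (t + k) k.+1 (a + k)%N.
  elim: k => [|k IH] kN a0; first by rewrite !addn0.
  have lt : (a + k < N)%N by rewrite -addnS.
  by rewrite (IH (ltnW lt) a0) (E_shift _ (leq_ltn_trans (leq_addl a k) lt) lt) !addnS.
have [a0 aN] : (0 < N.+1 - i)%N /\ (N.+1 - i <= N)%N by lia.
have aE : (N.+1 - i + i.-1 = N)%N by lia.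
have := H i.-1 _ _ a0; rewrite aE => /(_ (leqnn N)).
have lt : (i.-1 < N)%N by rewrite prednK.
rewrite (E_source t (a := N.+1 - i)) ?a0 ?aN // (E_exit _ lt) prednK // => ->.
by rewrite -addnS prednK // mulfV.
Qed.

(** Induction on the row, using the two preceding ones. The recurrences at (i, k + 1) and at its
    antipode, taken at matching times, are reciprocal to each other; once rows k and k + 1 and the
    right neighbour are known, only the vertex (i, k + 2) is left. *)
Lemma square_reciprocity k i t : (0 < i <= N)%N -> (0 < k <= N)%N ->
  x (t + i + k).-1 (i, k) * x t (N.+1 - i, N.+1 - k)%N = 1.
Proof.
have [n] := ubnP k; elim: n k i t => // n IH [|[|k]] i t kn iN // kN.
  by rewrite addn1 /= subSS subn0 edge_reciprocity.
have {}kN : (k.+1 < N)%N by case/andP: kN.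
have R1 j u : (0 < j <= N)%N ->
    x (u + j + k) (j, k.+1) * x u (N.+1 - j, N - k)%N = 1.
  by move=> jN; have := IH k.+1 j u; rewrite addnS subSS; apply => //; lia.
have R0 j u : (0 < j <= N)%N -> (0 < k)%N ->
    x (u + j + k).-1 (j, k) * x u (N.+1 - j, N.+1 - k)%N = 1.
  by move=> jN k0; apply: IH => //; lia.
have inv1 (a b : F) : a * b = 1 -> a = b^-1.
  move=> ab; have b0 : b != 0.
    by apply/eqP => b0; move/eqP: ab; rewrite b0 mulr0 eq_sym oner_eq0.
  by rewrite -[a](mulfK b0) ab mul1r.
pose s := (t + i + k)%N; pose v' := (N.+1 - i, N - k)%N.
(* The antipodal map exchanges upper and lower neighbours, and those involved here lie in rows
   already treated. *)
have ups : upsum N (x t.+1) v' = lowsum (x s) (i, k.+1).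
  rewrite /upsum /lowsum /sq_up /sq_low /v' /=.
  have -> : (N.+1 - i < N)%N = (1 < i)%N by apply/idP/idP; lia.
  have -> : (N - k < N)%N = (0 < k)%N by apply/idP/idP; lia.
  have -> : (1 < k.+1)%N = (0 < k)%N by [].
  rewrite !map_cat; congr (sum1 (_ ++ _)).
    case: ltnP => // i1; congr [:: _]; rewrite /s; symmetry.
    have ii : (0 < i.-1 <= N)%N by lia.
    have := inv1 _ _ (R1 i.-1 t.+1 ii).
    have -> : (t.+1 + i.-1 + k = t + i + k)%N by lia.
    by have -> : (N.+1 - i.-1 = (N.+1 - i).+1)%N by lia.
  case: ltnP => // k0; congr [:: _]; rewrite /s; symmetry.
  have := inv1 _ _ (R0 i t.+1 iN k0).
  have -> : ((t.+1 + i + k).-1 = t + i + k)%N by lia.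
  by have -> : (N.+1 - k = (N - k).+1)%N by lia.
have Dv : sq_dom N (i, k.+1) by rewrite /sq_dom /= iN ltnW.
have Dv' : sq_dom N v' by rewrite /sq_dom /v' /=; lia.
have e1 := x_orb.2 s _ Dv; have e2 := x_orb.2 t _ Dv'.
have r1 : x s (i, k.+1) = (x t v')^-1 by apply: inv1; apply: R1.
have r2 : x s.+1 (i, k.+1) = (x t.+1 v')^-1.
  by apply: inv1; rewrite /s -!addSn; apply: R1.
(* Comparing the two recurrences leaves the opposite exchange of neighbours, which involves the new
   row. *)
have key : upsum N (x s.+1) (i, k.+1) = lowsum (x t) v'.
  rewrite -[RHS]e2 -[sum1 _]/(upsum N _ _) ups -[lowsum _ _]e1 r1 r2.
  rewrite -[sum1 _]/(upsum N _ _); set U := upsum _ _ _.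
  by field; rewrite !x_neq0.
have -> : (t + i + k.+2).-1 = s.+1 by rewrite /s; lia.
rewrite subSS; move: key; rewrite /lowsum /sq_low /v' /=.
have -> : (1 < N - k)%N by lia.
have -> : (N - k.+1 = (N - k).-1)%N by lia.
(* At i = N the vertex lacks its right neighbour, and its antipode the left one. *)
have [iN'|iN'] : (i < N)%N \/ i = N by lia.
  rewrite upsumE //; have -> : (1 < N.+1 - i)%N by lia.
  rewrite /sum1 /=; have ii : (0 < i.+1 <= N)%N by lia.
  have := inv1 _ _ (R1 i.+1 t ii).
  have -> : (t + i.+1 + k = s.+1)%N by rewrite /s; lia.
  have -> : (N.+1 - i.+1 = (N.+1 - i).-1)%N by lia.
  by move=> ->; rewrite invrK => /addIr <-; rewrite mulfV.
rewrite iN' upsum_right // subSnn ltnn /sum1 /= => <-.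
by rewrite mulfV.
Qed.

End SquareReciprocity.

(** * Types A and B *)

Section TriangleGraph.
Context (n : nat).

Definition tri_dom (v : nat * nat) : bool := (0 < v.1 <= v.2) && (v.2 <= n).

Lemma tri_domE a b : tri_dom (a, b) = (0 < a <= b) && (b <= n).
Proof. by []. Qed.

Definition tri_up (v : nat * nat) : seq (nat * nat) :=
  (if 1 < v.1 then [:: (v.1.-1, v.2)] else [::]) ++
  (if v.2 < n then [:: (v.1, v.2.+1)] else [::]).

Definition tri_low (v : nat * nat) : seq (nat * nat) :=
  if v.1 < v.2 then [:: (v.1.+1, v.2); (v.1, v.2.-1)] else [::].

Definition tri_rk (v : nat * nat) : nat := v.2 - v.1.

Lemma tri_up_prop v w : tri_dom v -> w \in tri_up v ->
  tri_dom w && (tri_rk w == (tri_rk v).+1).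
Proof.
case: v => i j; rewrite /tri_dom /tri_up /tri_rk /= => ij.
by case: ltnP => iN; case: ltnP => jN; rewrite ?inE //=; try case/orP;
  move/eqP => -> /=; lia.
Qed.

Lemma tri_low_prop v w : tri_dom v -> w \in tri_low v ->
  tri_dom w && (tri_rk v == (tri_rk w).+1).
Proof.
case: v => i j; rewrite /tri_dom /tri_low /tri_rk /= => ij.
by case: ltnP => iN //; rewrite ?inE //= => /orP[] /eqP -> /=; lia.
Qed.

Definition triangle : cover_graph (nat * nat)%type.
Proof.
refine (@CoverGraph _ tri_dom tri_up tri_low tri_rk n.-1 _ _ _ _ _ _ _).
- by move=> v w Dv /(tri_up_prop Dv)/andP[].
- by move=> v w Dv /(tri_low_prop Dv)/andP[].
- by move=> v w Dv /(tri_up_prop Dv)/andP[_ /eqP].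
- by move=> v w Dv /(tri_low_prop Dv)/andP[_ /eqP].
- case=> i j; rewrite /tri_dom /tri_up /tri_rk /= => ij.
  by case: ltnP => iN; case: ltnP => jN //= _; lia.
- case=> i j; rewrite /tri_dom /tri_low /tri_rk /= => ij.
  by case: ltnP => iN //= _; lia.
- by case=> i j; rewrite /tri_dom /tri_rk /=; lia.
Defined.

End TriangleGraph.

(* The triangle is the part of the square strictly above its antidiagonal. The
   recurrence is invariant under negation combined with the reflection in the
   antidiagonal, provided that a vertex at distance r below it is read r steps
   later; this extends an orbit on the triangle to one on the square. *)
Section Doubling.
Context (n : nat) (f : nat -> nat * nat -> int).
Context (f_step : forall t, PLstep (triangle n) 0%R (f t) (f t.+1)).
Local Open Scope ring_scope.

Local Notation N := n.+1.

Definition double (t : nat) (v : nat * nat) : int :=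
  if (v.1 + v.2 == N.+1)%N then 0
  else if (N.+1 < v.1 + v.2)%N then f t (N.+1 - v.1, v.2.-1)%N
  else - f (t + (N.+1 - (v.1 + v.2)))%N (v.2, N - v.1)%N.

Lemma double_up t i j : (N.+1 < i + j)%N -> double t (i, j) = f t (N.+1 - i, j.-1)%N.
Proof. by move=> ij; rewrite /double /= gtn_eqF // ij. Qed.

Lemma double_mid t i j : (i + j = N.+1)%N -> double t (i, j) = 0.
Proof. by move=> ij; rewrite /double /= ij eqxx. Qed.

Lemma double_low t i j : (i + j < N.+1)%N ->
  double t (i, j) = - f (t + (N.+1 - (i + j)))%N (j, N - i)%N.
Proof. by move=> ij; rewrite /double /= ltn_eqF // ltnNge ltnW. Qed.

Lemma double_step t : PLstep (square N) 0 (double t) (double t.+1).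
Proof.
case=> i j; rewrite /= /sq_dom /= => ij.
have [lt|gt|eq] := ltngtP (i + j)%N N.+1.
(* Here the recurrence is that of [f] at time t + r at the reflected vertex, negated. Lower
   neighbours are at distance r + 1 and upper ones at distance r - 1, so that both are read at the
   right times. *)
- pose r := (N.+1 - (i + j))%N; rewrite !double_low // -/r.
  have [i1 j1] : (i < N)%N /\ (j < N)%N by lia.
  have Dv : dom (triangle n) (j, N - i)%N by rewrite /= /tri_dom /=; lia.
  have := f_step (t + r) Dv; rewrite /= /tri_up /tri_low /sq_up /sq_low /= i1 j1.
  have -> : (N - i < n)%N = (1 < i)%N by apply/idP/idP; lia.
  have lows : maxl 0 (map (double t) ((if (1 < i)%N then [:: (i.-1, j)] else [::]) ++
      (if (1 < j)%N then [:: (i, j.-1)] else [::]))) =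
    - minl 0 (map (f (t + r).+1) ((if (1 < j)%N then [:: (j.-1, N - i)%N] else [::]) ++
      (if (1 < i)%N then [:: (j, (N - i).+1)] else [::]))).
    case: ltnP => i2; case: ltnP => j2; rewrite /= ?double_low; try lia.
    + have -> : (t + (N.+1 - (i.-1 + j)) = (t + r).+1)%N by rewrite /r; lia.
      have -> : (t + (N.+1 - (i + j.-1)) = (t + r).+1)%N by rewrite /r; lia.
      have -> : (N - i.-1 = (N - i).+1)%N by lia.
      by rewrite /maxl /minl /=; lia.
    + have -> : (t + (N.+1 - (i.-1 + j)) = (t + r).+1)%N by rewrite /r; lia.
      by have -> : (N - i.-1 = (N - i).+1)%N by lia.
    + by have -> : (t + (N.+1 - (i + j.-1)) = (t + r).+1)%N by rewrite /r; lia.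
  rewrite lows.
  have ups : minl 0 (map (double t.+1) [:: (i.+1, j); (i, j.+1)]) =
    - maxl 0 (map (f (t + r))
        (if (j < N - i)%N then [:: (j.+1, N - i)%N; (j, (N - i).-1)] else [::])).
    case: ltnP => r1.
      rewrite /= !double_low; try lia.
      have -> : (t.+1 + (N.+1 - (i.+1 + j)) = t + r)%N by rewrite /r; lia.
      have -> : (t.+1 + (N.+1 - (i + j.+1)) = t + r)%N by rewrite /r; lia.
      have -> : (N - i.+1 = (N - i).-1)%N by lia.
      by rewrite /maxl /minl /=; lia.
    by rewrite /= !double_mid; try lia; rewrite /minl /maxl /=; lia.
  move=> E; rewrite -[X in _ = X - _]/(minl 0 (map (double t.+1) [:: (i.+1, j); (i, j.+1)])).
  by rewrite ups addSn -opprD E opprD addrC.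
- rewrite !double_up //.
  have Dv : dom (triangle n) (N.+1 - i, j.-1)%N by rewrite /= /tri_dom /=; lia.
  have := f_step t Dv; rewrite /= /tri_up /tri_low /sq_up /sq_low /= => ->.
  have -> : (1 < N.+1 - i)%N = (i < N)%N by apply/idP/idP; lia.
  have -> : (j.-1 < n)%N = (j < N)%N by apply/idP/idP; lia.
  have [-> ->] : (1 < i)%N /\ (1 < j)%N by lia.
  congr (_ + _).
    case: ltnP => i2; case: ltnP => j2; rewrite /= ?double_up //; try lia.
    + have -> : (N.+1 - i.+1 = (N.+1 - i).-1)%N by lia.
      by have -> : (j.-1.+1 = j)%N by lia.
    + by have -> : (N.+1 - i.+1 = (N.+1 - i).-1)%N by lia.
    + by have -> : (j.-1.+1 = j)%N by lia.
  case: ltnP => r1; last first.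
    by rewrite /= !double_mid; try lia; rewrite /maxl /=; lia.
  rewrite /= !double_up; try lia.
  by have -> : (N.+1 - i.-1 = (N.+1 - i).+1)%N by lia.
(* On the antidiagonal, the values above at time t + 1 are the opposites of those below at time t,
   so min and max cancel. *)
- rewrite !double_mid // addr0; rewrite /sq_up /sq_low /=.
  have -> : (i < N)%N = (1 < j)%N by apply/idP/idP; lia.
  have -> : (j < N)%N = (1 < i)%N by apply/idP/idP; lia.
  have u1 : (1 < j)%N -> double t.+1 (i.+1, j) = f t.+1 (j.-1, j.-1).
    by move=> j1; rewrite double_up; [congr (f _ (_, _)); lia|lia].
  have u2 : (1 < i)%N -> double t.+1 (i, j.+1) = f t.+1 (j, j).
    by move=> j1; rewrite double_up; [congr (f _ (_, _)); lia|lia].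
  have l1 : (1 < i)%N -> double t (i.-1, j) = - f t.+1 (j, j).
    by move=> j1; rewrite double_low; [congr (- f _ (_, _)); lia|lia].
  have l2 : (1 < j)%N -> double t (i, j.-1) = - f t.+1 (j.-1, j.-1).
    by move=> j1; rewrite double_low; [congr (- f _ (_, _)); lia|lia].
  case: ltnP => j2; case: ltnP => i2; rewrite /maxl /minl /= ?u1 ?u2 ?l1 ?l2 //; lia.
Qed.

(** The constant 1 has exponent 0, so the birational product identity becomes a vanishing sum of
    exponents. *)
Lemma square_PL_reciprocity (g : nat -> nat * nat -> int) M :
  (forall t, PLstep (square M) 0 (g t) (g t.+1)) ->
  forall k i t, (0 < i <= M)%N -> (0 < k <= M)%N ->
  g (t + i + k).-1 (i, k) = - g t (M.+1 - i, M.+1 - k)%N.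
Proof.
move=> gs k i t iM kM; have [X [Xorb Xa]] := tropicalization rat gs.
have D1 : dom (square M) (i, k) by rewrite /= /sq_dom /=; lia.
have D2 : dom (square M) (M.+1 - i, M.+1 - k)%N by rewrite /= /sq_dom /=; lia.
have := asympM (Xa (t + i + k).-1 _ D1) (Xa t _ D2).
move/(eq_asymp (y := fun=> 1)) => H; apply/eqP; rewrite -subr_eq0 opprK; apply/eqP.
apply: asymp_inj (H _) (asymp1 _) => z z1.
exact: (square_reciprocity (Xorb z z1) t iM kM).
Qed.

(** A vertex above the antidiagonal has its antipode below it, where [double] is a negated and
    delayed copy of [f]; the two signs cancel and the times differ by N. *)
Lemma triangle_flip t a b : tri_dom n (a, b) ->
  f (t + (tri_rk (a, b)).+1 + N)%N (a, b) =
  f (t + (tri_rk (a, b)).+1)%N (N - b, N - a)%N.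
Proof.
rewrite /tri_dom /tri_rk /= => ab.
have [iN kN] : (0 < N.+1 - a <= N)%N /\ (0 < b.+1 <= N)%N by lia.
have := square_PL_reciprocity double_step t iN kN.
rewrite double_up; last lia.
rewrite double_low; last lia.
have -> : (N.+1 - (N.+1 - a) = a)%N by lia.
have -> : ((t + (N.+1 - a) + b.+1).-1 = t + (b - a).+1 + N)%N by lia.
have -> : (t + (N.+1 - (a + (N.+1 - b.+1))) = t + (b - a).+1)%N by lia.
by rewrite subSS opprK.
Qed.

End Doubling.

(** A step of [C] raises [r] by one and leaves no room for an intermediate element; conversely a
    cover begins with a step of [C], which must already reach its upper end. *)
Lemma coversE (d : Order.disp_t) (P : finPOrderType d) (r : P -> nat) (C : rel P) :
  (forall x y, (x < y)%O -> r x < r y) ->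
  (forall x y, C x y -> (x < y)%O /\ r y = (r x).+1) ->
  (forall x y, (x < y)%O -> exists2 z, C x z & (z <= y)%O) ->
  forall x y, covers y x = C x y.
Proof.
move=> rlt Cr Cx x y; apply/idP/idP => [/andP[xy /forallP H]|/Cr[xy rxy]].
  have [z /[dup] xz /Cr[ltxz _]] := Cx _ _ xy.
  rewrite le_eqVlt => /orP[/eqP <- //|zy].
  by have := H z; rewrite ltxz zy.
rewrite /covers xy; apply/forallP => z; apply/negP => /andP[/rlt xz /rlt zy]; lia.
Qed.

(** * Coordinates on the posets of types A and B *)

Section PhiALabels.
Context (n : nat) (n_gt0 : 0 < n).
Implicit Types (p w : PhiA n) (v : nat * nat).

Local Notation c1 p := (nat_of_ord (val p).1).
Local Notation c2 p := (nat_of_ord (val p).2).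

Lemma PhiA_bounds p : (0 < c1 p <= c2 p) && (c2 p <= n).
Proof. by rewrite (valP p) -ltnS ltn_ord. Qed.

Lemma PhiA_ltE p w : (p < w)%O =
  [&& c1 w <= c1 p, c2 p <= c2 w & (c1 w != c1 p) || (c2 w != c2 p)].
Proof.
rewrite lt_def PhiA_leE /PhiA_le -val_eqE -pair_eqE /pair_eq /= negb_and -!val_eqE /=.
by rewrite andbC -andbA.
Qed.

Lemma PhiA_elt_bounds v : tri_dom n v -> v.1 < n.+1 /\ v.2 < n.+1.
Proof. by rewrite /tri_dom; lia. Qed.

Definition PhiA_elt v : PhiA n :=
  insubd (exist _ (inord 1, inord 1) (ltac:(by rewrite /= !inordK) :
    (1 <= (inord 1 : 'I_n.+1)) && ((inord 1 : 'I_n.+1) <= (inord 1 : 'I_n.+1))))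
  (inord v.1, inord v.2).

Lemma PhiA_eltE v : tri_dom n v -> (c1 (PhiA_elt v) = v.1) * (c2 (PhiA_elt v) = v.2).
Proof.
move=> Dv; have [v1 v2] := PhiA_elt_bounds Dv.
rewrite /PhiA_elt insubdK ?inordK // unfold_in /= !inordK //.
by move: Dv; rewrite /tri_dom => /andP[].
Qed.

Lemma PhiA_eqE w v : tri_dom n v -> (w == PhiA_elt v) = (c1 w == v.1) && (c2 w == v.2).
Proof.
move=> Dv; rewrite -val_eqE -pair_eqE /pair_eq /= -!val_eqE /=.
by rewrite !(PhiA_eltE Dv).
Qed.

Lemma PhiA_coords p : tri_dom n (c1 p, c2 p) /\ PhiA_elt (c1 p, c2 p) = p.
Proof.
have D : tri_dom n (c1 p, c2 p) by exact: PhiA_bounds.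
by split=> //; apply/esym/eqP; rewrite PhiA_eqE //= !eqxx.
Qed.

Lemma PhiA_covers p w : covers w p =
  ((c1 w).+1 == c1 p) && (c2 w == c2 p) || (c1 w == c1 p) && (c2 w == (c2 p).+1).
Proof.
move: p w; apply: (coversE (r := fun p => c2 p - c1 p)
  (C := fun p w => ((c1 w).+1 == c1 p) && (c2 w == c2 p) ||
                   (c1 w == c1 p) && (c2 w == (c2 p).+1))) => p w.
- by have := PhiA_bounds p; have := PhiA_bounds w; rewrite PhiA_ltE /=; lia.
- by have := PhiA_bounds p; have := PhiA_bounds w; rewrite PhiA_ltE /=; lia.
have := PhiA_bounds p; have := PhiA_bounds w; rewrite PhiA_ltE => bw bp lt.
have [l1|e1] : c1 w < c1 p \/ c1 w = c1 p by lia.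
  have D : tri_dom n ((c1 p).-1, c2 p) by rewrite tri_domE; lia.
  exists (PhiA_elt ((c1 p).-1, c2 p));
    rewrite ?PhiA_leE /PhiA_le !(PhiA_eltE D) -/(c1 p) -/(c2 p); cbn [fst snd]; lia.
have D : tri_dom n (c1 p, (c2 p).+1) by rewrite tri_domE; lia.
exists (PhiA_elt (c1 p, (c2 p).+1));
    rewrite ?PhiA_leE /PhiA_le !(PhiA_eltE D) -/(c1 p) -/(c2 p); cbn [fst snd]; lia.
Qed.

Definition PhiA_labelling : labelling (PhiA n) (triangle n).
Proof.
refine (@Labelling _ _ _ _ PhiA_elt (fun p => c2 p - c1 p) _ _ _ _).
- by move=> p; have [D <-] := PhiA_coords p; exists (c1 p, c2 p).
- by move=> v Dv; rewrite !(PhiA_eltE Dv).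
- move=> v Dv w; rewrite PhiA_covers !(PhiA_eltE Dv).
  have eqs u : u \in tri_up n v -> (w == PhiA_elt u) = (c1 w == u.1) && (c2 w == u.2).
    by move=> /(tri_up_prop Dv)/andP[Du _]; rewrite PhiA_eqE.
  move: eqs; have := PhiA_bounds w; move: Dv; rewrite /= /tri_dom /tri_up.
  by case: v => a b /= Dv bw; case: ltnP => a1; case: ltnP => b1 /= eqs;
    rewrite ?inE ?eqs ?inE ?eqxx ?orbT //=; apply/idP/idP; lia.
- move=> v Dv w; rewrite PhiA_covers !(PhiA_eltE Dv).
  have eqs u : u \in tri_low v -> (w == PhiA_elt u) = (c1 w == u.1) && (c2 w == u.2).
    by move=> /(tri_low_prop Dv)/andP[Du _]; rewrite PhiA_eqE.
  move: eqs; have := PhiA_bounds w; move: Dv; rewrite /= /tri_dom /tri_low.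
  by case: v => a b /= Dv bw; case: ltnP => a1 /= eqs;
    rewrite ?inE ?eqs ?inE ?eqxx ?orbT //=; apply/idP/idP; lia.
Defined.

End PhiALabels.

Section PhiBLabels.
Context (n : nat) (n_gt0 : 0 < n).
Implicit Types (p w : PhiB n) (v : nat * nat).

Local Notation c1 p := (nat_of_ord (val p).1).
Local Notation c2 p := (nat_of_ord (val p).2).
Local Notation m := (2 * n).-1.

Lemma PhiB_bounds p : [&& 0 < c1 p <= n, c1 p <= c2 p & c2 p <= 2 * n - c1 p].
Proof. by have /andP[-> /andP[-> ->]] := valP p; rewrite -ltnS ltn_ord. Qed.

Lemma PhiB_ltE p w : (p < w)%O =
  [&& c1 w <= c1 p, c2 w <= c2 p & (c1 w != c1 p) || (c2 w != c2 p)].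
Proof.
rewrite lt_def PhiB_leE /PhiB_le -val_eqE -pair_eqE /pair_eq /= negb_and -!val_eqE /=.
by rewrite andbC -andbA.
Qed.

Definition PhiB_elt0 (i j : nat) : PhiB n :=
  insubd (exist _ (inord 1, inord 1) (ltac:(rewrite /= !inordK; lia) :
    (1 <= (inord 1 : 'I_n.+1)) && ((inord 1 : 'I_n.+1) <= (inord 1 : 'I_(2 * n).+1)
       <= 2 * n - (inord 1 : 'I_n.+1))))
  (inord i, inord j).

(* The fibres of this map are the orbits of the reflection
   (a, b) -> (2n - b, 2n - a) of type A_(2n-1). *)
Definition PhiB_elt v : PhiB n :=
  PhiB_elt0 (minn v.1 (2 * n - v.2)) (maxn v.1 (2 * n - v.2)).

Lemma PhiB_elt0E i j : 0 < i <= n -> i <= j <= 2 * n - i ->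
  (c1 (PhiB_elt0 i j) = i) * (c2 (PhiB_elt0 i j) = j).
Proof.
move=> i1 ij; have [i2 j2] : i < n.+1 /\ j < (2 * n).+1 by lia.
by rewrite /PhiB_elt0 insubdK ?inordK // unfold_in /= !inordK // ij; case/andP: i1 => ->.
Qed.

Lemma PhiB_eltE v : tri_dom m v ->
  (c1 (PhiB_elt v) = minn v.1 (2 * n - v.2)) * (c2 (PhiB_elt v) = maxn v.1 (2 * n - v.2)).
Proof. by rewrite /tri_dom => Dv; apply: PhiB_elt0E; lia. Qed.

Lemma PhiB_eqE w v : tri_dom m v -> (w == PhiB_elt v) =
  (c1 w == minn v.1 (2 * n - v.2)) && (c2 w == maxn v.1 (2 * n - v.2)).
Proof.
move=> Dv; rewrite -val_eqE -pair_eqE /pair_eq /= -!val_eqE /=.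
by rewrite !(PhiB_eltE Dv).
Qed.

Lemma PhiB_covers p w : covers w p =
  ((c1 w).+1 == c1 p) && (c2 w == c2 p) || (c1 w == c1 p) && ((c2 w).+1 == c2 p).
Proof.
move: p w; apply: (coversE (r := fun p => 2 * n - c1 p - c2 p)
  (C := fun p w => ((c1 w).+1 == c1 p) && (c2 w == c2 p) ||
                   (c1 w == c1 p) && ((c2 w).+1 == c2 p))) => p w.
- by have := PhiB_bounds p; have := PhiB_bounds w; rewrite PhiB_ltE /=; lia.
- by have := PhiB_bounds p; have := PhiB_bounds w; rewrite PhiB_ltE /=; lia.
have := PhiB_bounds p; have := PhiB_bounds w; rewrite PhiB_ltE => bw bp lt.
have [l1|e1] : c1 w < c1 p \/ c1 w = c1 p by lia.
  have E : (c1 (PhiB_elt0 (c1 p).-1 (c2 p)) = (c1 p).-1) *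
           (c2 (PhiB_elt0 (c1 p).-1 (c2 p)) = c2 p) by apply: PhiB_elt0E; lia.
  by exists (PhiB_elt0 (c1 p).-1 (c2 p)); rewrite ?PhiB_leE /PhiB_le !E; lia.
have E : (c1 (PhiB_elt0 (c1 p) (c2 p).-1) = c1 p) *
         (c2 (PhiB_elt0 (c1 p) (c2 p).-1) = (c2 p).-1) by apply: PhiB_elt0E; lia.
by exists (PhiB_elt0 (c1 p) (c2 p).-1); rewrite ?PhiB_leE /PhiB_le !E; lia.
Qed.

(** The element (i, j) comes from the vertex (i, 2n - j). At a vertex on the axis of the reflection
    the upper neighbours share one label, and so do the lower ones, so that two entries of a list
    stand for one cover. *)
Definition PhiB_labelling : labelling (PhiB n) (triangle m).
Proof.
refine (@Labelling _ _ _ _ PhiB_elt (fun p => 2 * n - c1 p - c2 p) _ _ _ _).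
- move=> p; have bp := PhiB_bounds p.
  have D : tri_dom m (c1 p, 2 * n - c2 p) by rewrite tri_domE; lia.
  exists (c1 p, 2 * n - c2 p) => //; apply/esym/eqP; rewrite PhiB_eqE //; cbn [fst snd]; lia.
- by move=> v Dv; rewrite !(PhiB_eltE Dv); move: Dv; rewrite /= /tri_dom /tri_rk; lia.
- move=> v Dv w; rewrite PhiB_covers !(PhiB_eltE Dv).
  have eqs u : u \in tri_up m v -> (w == PhiB_elt u) =
      (c1 w == minn u.1 (2 * n - u.2)) && (c2 w == maxn u.1 (2 * n - u.2)).
    by move=> /(tri_up_prop Dv)/andP[Du _]; rewrite PhiB_eqE.
  move: eqs; have := PhiB_bounds w; move: Dv; rewrite /= /tri_dom /tri_up.
  by case: v => a b /= Dv bw; case: ltnP => a1; case: ltnP => b1 /= eqs;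
    rewrite ?inE ?eqs ?inE ?eqxx ?orbT //=; apply/idP/idP; lia.
- move=> v Dv w; rewrite PhiB_covers !(PhiB_eltE Dv).
  have eqs u : u \in tri_low v -> (w == PhiB_elt u) =
      (c1 w == minn u.1 (2 * n - u.2)) && (c2 w == maxn u.1 (2 * n - u.2)).
    by move=> /(tri_low_prop Dv)/andP[Du _]; rewrite PhiB_eqE.
  move: eqs; have := PhiB_bounds w; move: Dv; rewrite /= /tri_dom /tri_low.
  by case: v => a b /= Dv bw; case: ltnP => a1 /= eqs;
    rewrite ?inE ?eqs ?inE ?eqxx ?orbT //=; apply/idP/idP; lia.
Defined.

End PhiBLabels.

(** * Periods in types A and B *)

Section TriangleOrder.
Context (d : Order.disp_t) (P : finPOrderType d) (n : nat).
Context (l : labelling P (triangle n)).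
Context (R : realType) (ell : nat) (ell_gt0 : 0 < ell) (s : seq P).
Context (sle : linear_extension s).

Local Notation row := (rowmotion_perm R ell s).
Local Notation flip v := (n.+1 - v.2, n.+1 - v.1).

(** Since [triangle_flip] only reaches times beyond the rank, the orbit is started [k] steps
    earlier, which is possible because rowmotion is a permutation. Reflection preserves the rank, so
    the normalization cancels. *)
Lemma row_orbit_flip (T : PP P ell) (v : nat * nat) : tri_dom n v ->
  row_orbit l R s T n.+1 v = row_orbit l R s T 0 (flip v).
Proof.
case: v => a b Dv; pose k := (tri_rk (a, b)).+1.
pose T' := (row ^- k)%g T.
have TT' : (row ^+ k)%g T' = T by rewrite /T' -permM mulVg perm1.
have st t : PLstep (triangle n) 0%R (nrow_orbit l R s T' t) (nrow_orbit l R s T' t.+1).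
  exact: nrow_orbit_step.
have := triangle_flip st 0 Dv; rewrite -/k add0n /nrow_orbit.
have -> : row_orbit l R s T' k = row_orbit l R s T 0.
  by rewrite /row_orbit TT' expg0 perm1.
rewrite row_orbitD TT' /normalize /=.
have -> : tri_rk (n.+1 - b, n.+1 - a) = tri_rk (a, b).
  by move: Dv; rewrite tri_domE /tri_rk /=; lia.
by move/addIr/mulfI; apply.
Qed.

End TriangleOrder.

Section TypeA.
Context (n : nat).

Lemma hnum_PhiA : 0 < n -> hnum (PhiA n) = n.+1.
Proof.
move=> n0; rewrite (hnum_labelled (PhiA_labelling n0) (PhiA_elt n0 (1, 1))) /=.
by rewrite prednK.
Qed.

Context (R : realType) (ell : nat) (ell_gt0 : 0 < ell).

(** The reflection exchanges (1, 1) and (n, n), and this labelling tells them apart when n > 1. *)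
Definition PhiA_col1 : PP (PhiA n) ell.
Proof.
exists [ffun p : PhiA n => (if nat_of_ord (val p).1 == 1 then ord_max else ord0) : 'I_ell.+1].
apply/forallP => x; apply/forallP => y; apply/implyP.
rewrite PhiA_leE /PhiA_le !ffunE => /andP[yx _]; case: eqP => // x1.
have /andP[y1 _] := valP y.
by rewrite x1 in yx; rewrite (_ : nat_of_ord (val y).1 == 1) // eqn_leq yx y1.
Defined.

Lemma order_PhiA (s : seq (PhiA n)) : 1 < n -> linear_extension s ->
  #[rowmotion_perm R ell s]%g = 2 * hnum (PhiA n).
Proof.
move=> n1 sle; have n0 : 0 < n by apply: ltnW.
set l := PhiA_labelling n0.
have topE : (top (triangle n)).+2 = n.+1 by rewrite /= prednK.
have flipD v : tri_dom n v -> tri_dom n (n.+1 - v.2, n.+1 - v.1).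
  by case: v => a b; rewrite !tri_domE /=; lia.
apply: (order_double_period (l := l) (R := R) ell_gt0 sle).
  move=> T v Dv; rewrite topE mul2n -addnn row_orbitD (row_orbit_flip l R ell_gt0 sle) //.
  rewrite -row_orbitD addn0 (row_orbit_flip l R ell_gt0 sle) /=; last exact: flipD.
  have : tri_dom n v by exact: Dv.
  case: v {Dv} => a b; rewrite tri_domE /= => Dv.
  by congr (row_orbit _ _ _ _ _ (_, _)); lia.
exists PhiA_col1, (1, 1); rewrite topE (row_orbit_flip l R ell_gt0 sle) /=; last first.
  by rewrite tri_domE; lia.
rewrite /row_orbit expg0 perm1 /pp_int /= !ffunE.
have D1 : tri_dom n (1, 1) by rewrite tri_domE; lia.
have D2 : tri_dom n (n.+1 - 1, n.+1 - 1) by rewrite tri_domE; lia.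
rewrite !(PhiA_eltE n0 D1) !(PhiA_eltE n0 D2) /= subn1 /= (gtn_eqF n1) /= => -[e].
by move: ell_gt0; rewrite -e.
Qed.

End TypeA.

Section TypeB.
Context (n : nat) (n_gt0 : 0 < n).

Lemma hnum_PhiB : hnum (PhiB n) = 2 * n.
Proof.
by rewrite (hnum_labelled (PhiB_labelling n_gt0) (PhiB_elt n_gt0 (1, 1))) /=; lia.
Qed.

(** The reflection performed by 2n steps is invisible, because [PhiB_elt] is constant on its
    orbits. *)
Lemma order_PhiB (R : realType) (ell : nat) (s : seq (PhiB n)) : 0 < ell ->
  linear_extension s ->
  #[rowmotion_perm R ell s]%g = hnum (PhiB n).
Proof.
move=> ell_gt0 sle.
have topE : (top (triangle (2 * n).-1)).+2 = (2 * n).-1.+1 by rewrite /=; lia.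
apply: (order_period (l := PhiB_labelling n_gt0) ell_gt0 sle (PhiB_elt n_gt0 (1, 1))).
move=> T v Dv; rewrite topE (row_orbit_flip (PhiB_labelling n_gt0) R ell_gt0 sle) //.
rewrite /row_orbit /pp_int /=; congr (Posz (nat_of_ord (_ _))).
have : tri_dom (2 * n).-1 v by exact: Dv.
case: v {Dv} => a b; rewrite tri_domE /= /PhiB_elt => Dv.
by congr PhiB_elt0 => /=; lia.
Qed.

End TypeB.

(** * Type I_2(m) *)

Section DihedralGraph.
Context (m : nat).

(* The vertices 0 and 1 are a and b, and k.+2 is c_(k+1). *)
Definition I2_up (v : nat) : seq nat :=
  if (maxn v 1).+1 < m then [:: (maxn v 1).+1] else [::].

Definition I2_low (v : nat) : seq nat :=
  if v < 2 then [::] else if v == 2 then [:: 0; 1] else [:: v.-1].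

Lemma I2_up_prop v w : v < m -> w \in I2_up v -> (w < m) && (w.-1 == v.-1.+1).
Proof. by rewrite /I2_up; case: ifP => // lt _; rewrite inE => /eqP ->; lia. Qed.

Lemma I2_low_prop v w : v < m -> w \in I2_low v -> (w < m) && (v.-1 == w.-1.+1).
Proof.
move=> lt; rewrite /I2_low; case: ltnP => // v2; case: eqP => v3.
  by rewrite !inE => /orP[] /eqP ->; lia.
by rewrite mem_seq1 => /eqP ->; lia.
Qed.

Context (m_gt1 : 1 < m).

Definition dihedral : cover_graph nat.
Proof.
refine (@CoverGraph _ (fun v => v < m) I2_up I2_low predn (m - 2) _ _ _ _ _ _ _).
- by move=> v w Dv /(I2_up_prop Dv)/andP[].
- by move=> v w Dv /(I2_low_prop Dv)/andP[].
- by move=> v w Dv /(I2_up_prop Dv)/andP[_ /eqP].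
- by move=> v w Dv /(I2_low_prop Dv)/andP[_ /eqP].
- by rewrite /I2_up => v vm; case: ifP => //; lia.
- by rewrite /I2_low => v vm; case: ltnP => //; [lia|case: eqP].
- by move=> v; lia.
Defined.

End DihedralGraph.

Section DihedralOrbit.
Context (m : nat) (m_gt1 : 1 < m) (f : nat -> nat -> int).
Context (f_step : forall t, PLstep (dihedral m_gt1) 0%R (f t) (f t.+1)).
Local Open Scope ring_scope.

Let y t := f t m.-1.
Let S t k := \sum_(j < k) y (t + j).

Let SSr t k : S t k.+1 = S t k + y (t + k).
Proof. by rewrite /S big_ord_recr. Qed.

Let SSl t k : S t k.+1 = y t + S t.+1 k.
Proof.
rewrite /S big_ord_recl addn0; congr (_ + _).
by apply: eq_bigr => j _; rewrite addSnnS.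
Qed.

Let chain_step t v : (1 < v < m)%N ->
  f t.+1 v + f t v = (if (v.+1 < m)%N then f t.+1 v.+1 else 0) +
    (if v == 2 then Num.max (f t 0%N) (f t 1%N) else f t v.-1).
Proof.
move=> /andP[v1 vm]; rewrite (f_step t vm) /= /I2_up /I2_low.
have -> : maxn v 1 = v by lia.
have -> : (v < 2)%N = false by lia.
congr (_ + _); first by case: ifP.
by case: eqP => // _; rewrite /maxl /= maxC.
Qed.

(** On the chain every minimum and maximum has one term, so the recurrence is linear and expresses
    each value through those above it, starting from the maximal vertex. *)
Let chain_sum k t : (k.+2 < m)%N -> f t (m.-1 - k)%N = S t k.+1.
Proof.
have [K] := ubnP k; elim: K k t => // K IH [|k] t kK km.
  by rewrite subn0 SSr /S big_ord0 add0r addn0.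
have v1 : (1 < m.-1 - k < m)%N by lia.
have := chain_step t v1; rewrite !(IH k); try lia.
have -> : (m.-1 - k == 2)%N = false by lia.
have -> : ((m.-1 - k).-1 = m.-1 - k.+1)%N by lia.
case: k kK km v1 => [|k] kK km v1.
  rewrite ifF; last lia.
  by rewrite !SSr /S !big_ord0 !addn0 addn1; lia.
rewrite ifT; last lia.
have -> : ((m.-1 - k.+1).+1 = m.-1 - k)%N by lia.
rewrite (IH k); try lia.
by rewrite !(SSr _ k.+2) !(SSr _ k.+1) !addnS !addSn; lia.
Qed.

(** The recurrence at vertex 2 extends [chain_sum] by one term, with the larger of the two minimal
    values in the place of the next vertex down. *)
Let max_sum t : (2 < m)%N -> Num.max (f t 0%N) (f t 1%N) = S t m.-1.
Proof.
move=> m2; have := chain_step t (v := 2); rewrite m2 eqxx => /(_ isT).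
have e2 u : f u 2 = S u (m - 2)%N.
  have := @chain_sum (m - 3) u ltac:(lia).
  have -> : (m.-1 - (m - 3) = 2)%N by lia.
  by have -> : ((m - 3).+1 = m - 2)%N by lia.
have -> : (m.-1 = (m - 2).+1)%N by lia.
have -> : (m - 2 = (m - 3).+1)%N by lia.
(* For m = 3 the vertex 3 is absent and the sum is empty. *)
have e3 u : (if (3 < m)%N then f u 3 else 0) = S u (m - 3)%N.
  case: ltnP => m3; last first.
    have -> : (m - 3 = 0)%N by lia.
    by rewrite /S big_ord0.
  have := @chain_sum (m - 4) u ltac:(lia).
  have -> : (m.-1 - (m - 4) = 3)%N by lia.
  by have -> : ((m - 4).+1 = m - 3)%N by lia.
rewrite e3 !e2; have -> : (m - 2 = (m - 3).+1)%N by lia.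
by rewrite (SSr _ (m - 3).+1) !(SSr _ (m - 3)%N) addSn addnS; lia.
Qed.

Let low_step t v : (v < 2)%N -> f t.+1 v + f t v = if (2 < m)%N then f t.+1 2 else 0.
Proof.
move=> v2; have vm : dom (dihedral m_gt1) v by rewrite /=; lia.
rewrite (f_step t vm) /= /I2_up /I2_low v2.
have -> : maxn v 1 = 1%N by lia.
by case: ifP => _; rewrite addr0.
Qed.

Let diff_step t : f t.+1 0%N - f t.+1 1%N = - (f t 0%N - f t 1%N).
Proof. by have := low_step t (v := 0); have := low_step t (v := 1); lia. Qed.

Let diff_iter t k : f (t + k)%N 0%N - f (t + k)%N 1%N =
  if odd k then - (f t 0%N - f t 1%N) else f t 0%N - f t 1%N.
Proof.
elim: k => [|k IH]; first by rewrite addn0.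
by rewrite addnS diff_step IH /=; case: odd; rewrite ?opprK.
Qed.

(** The recurrence at the minimal vertices, with [max_sum] at time u + 1, shows that y (u + m - 1)
    is the opposite of the smaller of [f u 0] and [f u 1]. With [max_sum] at time u, m consecutive
    values then add up to |f u 0 - f u 1|, which does not depend on u. *)
Let y_period t : (2 < m)%N -> y (t + m) = y t.
Proof.
move=> m2.
have Z u : S u m = `|f u 0%N - f u 1%N|.
  have := max_sum u m2; have := max_sum u.+1 m2; have := diff_step u.
  have := low_step u (v := 0); rewrite m2 => /(_ isT).
  have := @chain_sum (m - 3) u.+1 ltac:(lia).
  have -> : (m.-1 - (m - 3) = 2)%N by lia.
  have -> : ((m - 3).+1 = m - 2)%N by lia.
  have : S u m = S u m.-1 + y (u + m.-1) by rewrite -SSr prednK // ltnW.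
  have : S u.+1 m.-1 = S u.+1 (m - 2) + y (u + m.-1).
    have -> : (m.-1 = (m - 2).+1)%N by lia.
    by rewrite SSr addSn addnS.
  lia.
have := Z t; have := Z t.+1; rewrite diff_step normrN => <-.
have -> : m = m.-1.+1 by lia.
by rewrite SSl SSr addSn addnS; lia.
Qed.

(** Periodicity of [y] settles the chain and the larger of the two minimal values, while their
    difference has changed sign m times. For m = 2 there is no chain, and each step negates the
    values. *)
Lemma dihedral_period t v : (v < m)%N ->
  f (t + m)%N v = f t (if odd m && (v < 2)%N then 1 - v else v)%N.
Proof.
move=> vm; have [m2|m2] := ltnP 2 m; last first.
  have m2E : m = 2%N by lia.
  have := low_step t (v := v); have := low_step t.+1 (v := v).
  by rewrite m2E ltnn /= addn2 -m2E => /(_ vm) E1 /(_ vm) E0; lia.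
have SP u k : S (u + m) k = S u k.
  by apply: eq_bigr => j _; rewrite addnAC y_period.
have [v2|v2] := leqP 2 v.
  rewrite andbF; have -> : (v = m.-1 - (m.-1 - v))%N by lia.
  by rewrite !chain_sum ?SP //; lia.
have := max_sum t m2; have := max_sum (t + m) m2; have := diff_iter t m.
have [->|->] : v = 0%N \/ v = 1%N by lia.
  by rewrite SP ?subn0 ?subnn /=; case: (odd m) => /=; lia.
by rewrite SP ?subn0 ?subnn /=; case: (odd m) => /=; lia.
Qed.

End DihedralOrbit.

Section PhiI2Labels.
Context (m : nat) (m_gt1 : 1 < m).
Implicit Types (p w : PhiI2 m) (v : nat).

Definition I2_idx p : nat := match p with inl b => ~~ b | inr k => k.+2 end.

Definition I2_elt v : PhiI2 m :=
  if v is k.+2 then (if insub k is Some i then inr i else inl true) else inl (v == 0).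

Lemma I2_idx_lt p : I2_idx p < m.
Proof. by case: p => [[]|[k kn]] /=; lia. Qed.

Lemma I2_idxK p : I2_elt (I2_idx p) = p.
Proof. by case: p => [[]|k] //=; rewrite valK. Qed.

Lemma I2_eltK v : v < m -> I2_idx (I2_elt v) = v.
Proof.
case: v => [|[|k]] //= km; case: insubP => [i _ <- //|].
by rewrite -leqNgt; lia.
Qed.

Lemma I2_mem w (r : seq nat) : (forall u, u \in r -> u < m) ->
  (w \in map I2_elt r) = (I2_idx w \in r).
Proof.
move=> rm; apply/mapP/idP => [[u ur ->]|wr]; first by rewrite I2_eltK ?rm.
by exists (I2_idx w); rewrite ?I2_idxK.
Qed.

Lemma I2_lt p w : (p < w)%O = (I2_idx p < I2_idx w) && (1 < I2_idx w).
Proof.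
rewrite lt_def PhiI2_leE.
case: p => [[]|[i im]]; case: w => [[]|[j jm]] //=.
have -> : (inr (Ordinal jm) == inr (Ordinal im) :> PhiI2 m) = (j == i) by [].
by apply/idP/idP; lia.
Qed.

Lemma I2_covers p w : covers w p = (I2_idx w == (maxn (I2_idx p) 1).+1).
Proof.
move: p w; apply: (coversE (r := fun p => (I2_idx p).-1)
  (C := fun p w => I2_idx w == (maxn (I2_idx p) 1).+1)) => p w.
- by rewrite I2_lt; lia.
- by rewrite I2_lt; lia.
rewrite I2_lt => lt; have wm := I2_idx_lt w.
have um : (maxn (I2_idx p) 1).+1 < m by lia.
exists (I2_elt (maxn (I2_idx p) 1).+1); first by rewrite I2_eltK.
rewrite le_eqVlt I2_lt I2_eltK //.
have [//|ne] := eqVneq w (I2_elt (maxn (I2_idx p) 1).+1); rewrite /=.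
have : I2_idx w != (maxn (I2_idx p) 1).+1.
  by apply: contraNneq ne => e; rewrite -e I2_idxK.
lia.
Qed.

Definition PhiI2_labelling : labelling (PhiI2 m) (dihedral m_gt1).
Proof.
refine (@Labelling _ _ _ _ I2_elt (fun p => (I2_idx p).-1) _ _ _ _).
- by move=> p; exists (I2_idx p); [exact: I2_idx_lt|exact: I2_idxK].
- by move=> v Dv; rewrite I2_eltK.
- move=> v Dv w; rewrite I2_covers I2_eltK // I2_mem; last first.
    by move=> u /(I2_up_prop Dv)/andP[].
  have := I2_idx_lt w; rewrite /= /I2_up; case: ifP => lt wm; first by rewrite inE.
  by rewrite in_nil; apply/eqP; lia.
- move=> v Dv w; rewrite I2_covers I2_eltK // I2_mem; last first.
    by move=> u /(I2_low_prop Dv)/andP[].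
  rewrite /= /I2_low; case: ltnP => v2; first by rewrite in_nil; apply/eqP; lia.
  by case: (v =P 2) => v3; rewrite !inE; apply/idP/idP; lia.
Defined.

Lemma hnum_PhiI2 : hnum (PhiI2 m) = m.
Proof. by rewrite (hnum_labelled PhiI2_labelling (inl true)) /=; lia. Qed.

Context (R : realType) (ell : nat) (ell_gt0 : 0 < ell).

(** It separates a from b, which m steps exchange when m is odd. *)
Definition PhiI2_corner : PP (PhiI2 m) ell.
Proof.
exists [ffun p : PhiI2 m => (if I2_idx p == 0 then ord0 else ord_max) : 'I_ell.+1].
apply/forallP => x; apply/forallP => y; apply/implyP.
rewrite le_eqVlt I2_lt => /orP[/eqP -> //|]; rewrite !ffunE.
by case: (I2_idx x) => //= i; case: (I2_idx y).
Defined.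

Lemma order_PhiI2 (s : seq (PhiI2 m)) : linear_extension s ->
  #[rowmotion_perm R ell s]%g = if odd m then 2 * hnum (PhiI2 m) else hnum (PhiI2 m).
Proof.
move=> sle; set l := PhiI2_labelling.
have topE : (top (dihedral m_gt1)).+2 = m by rewrite /=; lia.
have per (T : PP (PhiI2 m) ell) t v : v < m -> row_orbit l R s T (t + m) v =
    row_orbit l R s T t (if odd m && (v < 2) then 1 - v else v).
  move=> vm; have st u := nrow_orbit_step l R ell_gt0 sle T u.
  have := dihedral_period st t vm; rewrite /nrow_orbit /normalize /=.
  have -> : (if odd m && (v < 2) then 1 - v else v).-1 = v.-1.
    by case: ifP => // /andP[_]; lia.
  by move/addIr/mulfI; apply.
case: ifP => om; rewrite om /= in per.
  apply: (order_double_period (l := l) (R := R) ell_gt0 sle).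
    move=> T v Dv; have {}Dv : v < m by exact: Dv.
    rewrite topE mul2n -addnn per //; rewrite -[m in row_orbit _ _ _ _ m]add0n per.
      rewrite (_ : (if _ < 2 then _ else _) = v) //.
      by case: (ltnP v 2) => v2; [rewrite ifT; lia|rewrite ifF; lia].
    by case: ifP => //; lia.
  exists PhiI2_corner, 0; rewrite topE -[m in row_orbit _ _ _ _ m]add0n per; last lia.
  rewrite /row_orbit expg0 perm1 /pp_int /= !ffunE /= => -[e].
  by move: ell_gt0; rewrite e.
apply: (order_period (l := l) ell_gt0 sle (inl true)) => T v Dv.
by rewrite topE -[m in row_orbit _ _ _ _ m]add0n per.
Qed.

End PhiI2Labels.

(** * Type H_3 *)

Section H3Graph.

Definition H3_up (v : nat) : seq nat := [seq c.1 | c <- H3_covers & c.2 == v].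
Definition H3_low (v : nat) : seq nat := [seq c.2 | c <- H3_covers & c.1 == v].
Definition H3_rk (v : nat) : nat :=
  nth 0 [:: 0; 0; 0; 0; 1; 1; 2; 2; 3; 3; 4; 4; 5; 6; 7; 8] v.
(** Membership in an explicit list reduces statements about all vertices to evaluations of [all]. *)
Definition H3_dom (v : nat) : bool := v \in iota 1 15.

Lemma H3_covers_prop c : c \in H3_covers ->
  [&& H3_dom c.1, H3_dom c.2 & H3_rk c.1 == (H3_rk c.2).+1].
Proof.
have /allP : all (fun c => [&& H3_dom c.1, H3_dom c.2 & H3_rk c.1 == (H3_rk c.2).+1])
  H3_covers by [].
exact.
Qed.

Lemma mem_H3_up v w : (w \in H3_up v) = ((w, v) \in H3_covers).
Proof.
apply/mapP/idP => [[[a b]]|wv]; first by rewrite mem_filter /= => /andP[/eqP <- ab] ->.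
by exists (w, v); rewrite // mem_filter /= eqxx.
Qed.

Lemma mem_H3_low v w : (w \in H3_low v) = ((v, w) \in H3_covers).
Proof.
apply/mapP/idP => [[[a b]]|wv]; first by rewrite mem_filter /= => /andP[/eqP <- ab] ->.
by exists (v, w); rewrite // mem_filter /= eqxx.
Qed.

Definition H3_graph : cover_graph nat.
Proof.
refine (@CoverGraph _ H3_dom H3_up H3_low H3_rk 8 _ _ _ _ _ _ _).
- by move=> v w _; rewrite mem_H3_up => /H3_covers_prop/and3P[].
- by move=> v w _; rewrite mem_H3_low => /H3_covers_prop/and3P[].
- by move=> v w _; rewrite mem_H3_up => /H3_covers_prop/and3P[_ _ /eqP].
- by move=> v w _; rewrite mem_H3_low => /H3_covers_prop/and3P[_ _ /eqP].
- move=> v Dv /eqP nil; have /allP/(_ v Dv)/implyP/(_ nil)/eqP // :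
    all (fun v => (H3_up v == [::]) ==> (H3_rk v == 8)) (iota 1 15) by [].
- move=> v Dv /eqP nil; have /allP/(_ v Dv)/implyP/(_ nil)/eqP // :
    all (fun v => (H3_low v == [::]) ==> (H3_rk v == 0)) (iota 1 15) by [].
- move=> v Dv; have /allP/(_ v Dv) // : all (fun v => H3_rk v <= 8) (iota 1 15) by [].
Defined.

Definition H3_elt (v : nat) : PhiH3 := inord v.-1.

Lemma H3_elt_dom v : H3_dom v -> (H3_elt v).+1 = v.
Proof. by rewrite /H3_dom mem_iota => Dv; rewrite inordK; lia. Qed.

Lemma H3_ord_dom (p : PhiH3) : H3_dom p.+1 /\ H3_elt p.+1 = p.
Proof.
split; last by rewrite /H3_elt inord_val.
by rewrite /H3_dom mem_iota; have := ltn_ord p; lia.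
Qed.

Lemma H3_rk_lt (p w : PhiH3) : (p < w)%O -> H3_rk p.+1 < H3_rk w.+1.
Proof.
rewrite lt_def PhiH3_leE => /andP[ne /connectP[r]]; elim: r p ne => [|z r IH] p ne /=.
  by move=> _ e; rewrite e eqxx in ne.
case/andP=> /H3_covers_prop/and3P[_ _ /eqP /= zr] zp wE.
have [e|ne'] := eqVneq w z; first by rewrite e zr.
by apply: ltn_trans (IH _ ne' zp wE); rewrite zr.
Qed.

Lemma H3_coversE (p w : PhiH3) : covers w p = ((w.+1, p.+1) \in H3_covers).
Proof.
move: p w; apply: (coversE (r := fun p : PhiH3 => H3_rk p.+1) (C := H3_covered)) => p w.
- exact: H3_rk_lt.
- move=> pw; have /and3P[_ _ /eqP r] := H3_covers_prop pw; split=> //.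
  rewrite lt_def PhiH3_leE /PhiH3_le connect1 // andbT.
  by apply/eqP => e; move: r; rewrite e /=; lia.
rewrite lt_def PhiH3_leE => /andP[ne /connectP[[|z r]]] /=.
  by move=> _ e; rewrite e eqxx in ne.
by case/andP=> pz zr wE; exists z => //; rewrite PhiH3_leE; apply/connectP; exists r.
Qed.

Lemma H3_mem (w : PhiH3) (r : seq nat) : (forall u, u \in r -> H3_dom u) ->
  (w \in map H3_elt r) = (w.+1 \in r).
Proof.
move=> rD; apply/mapP/idP => [[u ur ->]|wr]; first by rewrite H3_elt_dom ?rD.
by exists w.+1 => //; have [] := H3_ord_dom w.
Qed.

Definition H3_labelling : labelling PhiH3 H3_graph.
Proof.
refine (@Labelling _ _ _ _ H3_elt (fun p => H3_rk p.+1) _ _ _ _).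
- by move=> p; exists p.+1; have [] := H3_ord_dom p.
- by move=> v Dv; rewrite /= H3_elt_dom.
- move=> v Dv w; rewrite H3_coversE H3_elt_dom // H3_mem ?mem_H3_up //.
  by move=> u; rewrite mem_H3_up => /H3_covers_prop/and3P[].
- move=> v Dv w; rewrite H3_coversE H3_elt_dom // H3_mem ?mem_H3_low //.
  by move=> u; rewrite mem_H3_low => /H3_covers_prop/and3P[].
Defined.

End H3Graph.

(* In the coordinates y, p, u, w, q, s, k below, rowmotion on H_3 is the
   recurrence in which each of the relations ts1, ..., ts6, tsk determines the
   newest of its variables. *)
Record tsystem (F : realFieldType) (y p u w q s k : nat -> F) : Prop := TSystem {
  ts1 : forall t, (u t + w t = y t * y t.+1 * y t.+2 * y t.+3 * y t.+4)%R;
  ts2 : forall t, (u t * u t.+1 + p t * p t.+1 * (y t.+1 * y t.+2 * y t.+3 * y t.+4)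
    = w t * w t.+1)%R;
  ts3 : forall t, (s t * w t.+1 + p t * p t.+1 ^+ 2 * p t.+2 * (y t.+2 * y t.+3 * y t.+4)
    = u t * u t.+1 * u t.+2)%R;
  ts4 : forall t, (s t.+1 + p t.+1 * p t.+2 * p t.+3 * y t.+4
    = q t * q t.+1 * q t.+2)%R;
  ts5 : forall t, (q t.+1 * u t.+2 + k t * s t.+1
    = p t * p t.+1 * p t.+2 * p t.+3 * p t.+4)%R;
  ts6 : forall t, (p t * p t.+1 ^+ 2 * p t.+2 ^+ 2 * p t.+3 * (y t.+3 * y t.+4)
    + q t * q t.+1 * u t.+1 * u t.+2 = s t * s t.+1)%R;
  tsk : forall t, (k t * k t.+1 = 1)%R
}.

Section TSystemOrbit.
Context (F : realFieldType) (y p u w q s k : nat -> F).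
Context (ts : tsystem y p u w q s k).
Local Open Scope ring_scope.

Let pos4 (f : nat -> F) t := [/\ 0 < f t, 0 < f t.+1, 0 < f t.+2 & 0 < f t.+3].

Definition ts_pos t : Prop :=
  [/\ pos4 y t, pos4 p t, [/\ 0 < u t, 0 < u t.+1 & 0 < w t] &
      [/\ 0 < q t, 0 < q t.+1, 0 < s t & 0 < k t]].

(** Each relation gives its newest variable by a subtraction-free formula, so positivity of a window
    of consecutive terms moves forward. *)
Lemma ts_posS t : ts_pos t -> ts_pos t.+1.
Proof.
move=> [[y0 y1 y2 y3] [p0 p1 p2 p3] [u0 u1 w0] [q0 q1 s0 k0]].
have cancel (a b : F) : 0 < a -> 0 < a * b -> 0 < b by move=> a0; rewrite pmulr_rgt0.
have y4 : 0 < y t.+4.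
  by apply: (cancel (y t * y t.+1 * y t.+2 * y t.+3)); rewrite -?(ts1 ts) ?addr_gt0 ?mulr_gt0.
have w1 : 0 < w t.+1.
  by apply: (cancel (w t)); rewrite // -(ts2 ts) addr_gt0 ?mulr_gt0.
have u2 : 0 < u t.+2.
  by apply: (cancel (u t * u t.+1)); rewrite -?(ts3 ts) ?addr_gt0 ?mulr_gt0 ?exprn_gt0.
have s1 : 0 < s t.+1.
  by apply: (cancel (s t)); rewrite // -(ts6 ts) addr_gt0 ?mulr_gt0 ?exprn_gt0.
have q2 : 0 < q t.+2.
  by apply: (cancel (q t * q t.+1)); rewrite -?(ts4 ts) ?addr_gt0 ?mulr_gt0.
have p4 : 0 < p t.+4.
  apply: (cancel (p t * p t.+1 * p t.+2 * p t.+3)); first by rewrite !mulr_gt0.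
  by rewrite -(ts5 ts) addr_gt0 ?mulr_gt0.
have k1 : 0 < k t.+1 by apply: (cancel (k t)); rewrite // (tsk ts).
by split; split.
Qed.

Context (pos0 : ts_pos 0).

Lemma ts_posP t : ts_pos t.
Proof. by elim: t => // t /ts_posS. Qed.

Lemma ts_y_gt0 t : 0 < y t. Proof. by have [[]] := ts_posP t. Qed.
Lemma ts_p_gt0 t : 0 < p t. Proof. by have [_ []] := ts_posP t. Qed.
Lemma ts_u_gt0 t : 0 < u t. Proof. by have [_ _ []] := ts_posP t. Qed.
Lemma ts_w_gt0 t : 0 < w t. Proof. by have [_ _ []] := ts_posP t. Qed.
Lemma ts_q_gt0 t : 0 < q t. Proof. by have [_ _ _ []] := ts_posP t. Qed.
Lemma ts_s_gt0 t : 0 < s t. Proof. by have [_ _ _ []] := ts_posP t. Qed.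
Lemma ts_k_gt0 t : 0 < k t. Proof. by have [_ _ _ []] := ts_posP t. Qed.

(** From [x_12] to [x_15] the values are products of consecutive terms of [y], the birational form
    of the sums in type I_2; [u] and [w] are the values at the two branches [x_10] and [x_11]. *)
Definition ts_x (t v : nat) : F :=
  match v with
  | 1%N => q t.+1 / y t.+4
  | 2%N => p t.+1 * p t.+2 * p t.+3 * q t.+1 / s t.+1
  | 3%N => k t * (p t.+1 * p t.+2 * p t.+3) / u t.+2
  | 4%N => q t * q t.+1 / (y t.+3 * y t.+4)
  | 5%N => p t * p t.+1 ^+ 2 * p t.+2 ^+ 2 * p t.+3 / (u t.+1 * u t.+2)
  | 6%N => s t / (y t.+2 * y t.+3 * y t.+4)
  | 7%N => p t * p t.+1 ^+ 2 * p t.+2 / w t.+1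
  | 8%N => u t * u t.+1 / (y t.+1 * y t.+2 * y t.+3 * y t.+4)
  | 9%N => p t * p t.+1
  | 10%N => u t
  | 11%N => w t
  | 12%N => y t * y t.+1 * y t.+2 * y t.+3
  | 13%N => y t * y t.+1 * y t.+2
  | 14%N => y t * y t.+1
  | 15%N => y t
  | _ => 1
  end.

Definition ts_gt0 := (ts_y_gt0, ts_p_gt0, ts_u_gt0, ts_w_gt0, ts_q_gt0, ts_s_gt0, ts_k_gt0).

Lemma ts_neq0 t : (y t != 0) * (p t != 0) * (u t != 0) * (w t != 0) *
  (q t != 0) * (s t != 0) * (k t != 0).
Proof. by rewrite !gt_eqF ?ts_gt0. Qed.

(** Each sum over a pair of neighbours collapses to a monomial: [ts1] for 10 and 11, [ts2] for 8 and
    9, [ts3] for 6 and 7, [ts4] for 1 and 2, [ts5] for 2 and 3, [ts6] for 4 and 5. The vertex 3 uses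
    [tsk], and the remaining ones give monomial identities. *)
Lemma ts_x_step t : BRstep H3_graph (ts_x t) (ts_x t.+1).
Proof.
have ne := ts_neq0; move=> v Dv; have {Dv} : v \in iota 1 15 := Dv.
rewrite !inE => /orP[|]; last do 13?[case/orP=> [|]]; move=> /eqP ->; rewrite /= /sum1 /=.
all: try by field; rewrite !ne.
- rewrite [X in _ * X](_ : _ = s t.+1 * s t.+2 /
    (p t.+1 * p t.+2 ^+ 2 * p t.+3 ^+ 2 * p t.+4 * q t.+1 * q t.+2)).
    by field; rewrite !ne.
  by rewrite -(ts6 ts); field; rewrite !ne.
- have -> : k t.+1 = (k t)^-1.
    by rewrite -[LHS]mul1r -[in LHS](mulVf (ne t).2) -mulrA (tsk ts) mulr1.
  by field; rewrite !ne.
- rewrite [RHS](_ : _ = q t.+1 * (q t * q t.+1 * q t.+2) / (s t.+1 * y t.+4)).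
    by field; rewrite !ne.
  by rewrite -(ts4 ts); field; rewrite !ne.
- rewrite [X in _ * X](_ : _ = u t.+1 * u t.+2 * u t.+3 /
    (p t.+1 * p t.+2 ^+ 2 * p t.+3 * s t.+1)); last first.
    by rewrite -(ts3 ts); field; rewrite !ne.
  rewrite [RHS](_ : _ = p t.+1 * p t.+2 * p t.+3 *
    (p t * p t.+1 * p t.+2 * p t.+3 * p t.+4) / (u t.+2 * s t.+1)).
    by field; rewrite !ne.
  by rewrite -(ts5 ts); field; rewrite !ne.
- rewrite [RHS](_ : _ = s t * s t.+1 / (u t.+1 * u t.+2 * (y t.+3 * y t.+4))).
    by field; rewrite !ne.
  by rewrite -(ts6 ts); field; rewrite !ne.
- rewrite [X in _ * X](_ : _ = w t.+1 * w t.+2 / (p t.+1 * p t.+2 * u t.+1 * u t.+2)).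
    by field; rewrite !ne.
  by rewrite -(ts2 ts); field; rewrite !ne.
- rewrite [X in _ * X](_ : _ = (u t.+1 + w t.+1) / (u t.+1 * w t.+1)); last first.
    by field; rewrite !ne.
  rewrite (ts1 ts) [RHS](_ : _ = u t * u t.+1 * u t.+2 /
    (w t.+1 * (y t.+2 * y t.+3 * y t.+4))).
    by field; rewrite !ne.
  by rewrite -(ts3 ts); field; rewrite !ne.
- rewrite [RHS](_ : _ = w t * w t.+1 / (y t.+1 * y t.+2 * y t.+3 * y t.+4)).
    by field; rewrite !ne.
  by rewrite -(ts2 ts); field; rewrite !ne.
- by rewrite [RHS]addrC (ts1 ts); field; rewrite !ne.
- by rewrite mulr1 mulrC.
Qed.

End TSystemOrbit.

Section H3Seed.
Context (F : realFieldType).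
Local Open Scope ring_scope.

(** The fifteen values of [x] determine the fifteen seed variables one after another by
    subtraction-free formulas. The second half concerns every T-system with this seed, so that it
    applies to sequences constructed from the seed afterwards. *)
Lemma H3_seed (x : nat -> F) : posfun x ->
  exists y0 y1 y2 y3 p0 p1 p2 p3 u0 u1 w0 q0 q1 s0 k0 : F,
  [/\ [/\ 0 < y0, 0 < y1, 0 < y2 & 0 < y3], [/\ 0 < p0, 0 < p1, 0 < p2 & 0 < p3],
      [/\ 0 < u0, 0 < u1 & 0 < w0] & [/\ 0 < q0, 0 < q1, 0 < s0 & 0 < k0]] /\
  forall y p u w q s k : nat -> F, tsystem y p u w q s k ->
  [/\ [/\ y 0 = y0, y 1 = y1, y 2 = y2 & y 3 = y3],
      [/\ p 0 = p0, p 1 = p1, p 2 = p2 & p 3 = p3],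
      [/\ u 0 = u0, u 1 = u1 & w 0 = w0] &
      [/\ q 0 = q0, q 1 = q1, s 0 = s0 & k 0 = k0]]%N ->
  {in dom H3_graph, ts_x y p u w q s k 0 =1 x}.
Proof.
move=> x0; have xn v : x v != 0 by rewrite gt_eqF.
pose y0 := x 15; pose y1 := x 14 / x 15; pose y2 := x 13 / x 14; pose y3 := x 12 / x 13.
(* The terms [y4], [w1], [u2] and [s1] lie outside the seed; they are prescribed by [ts1], [ts2],
   [ts3] and [ts6]. *)
pose y4 := (x 10 + x 11) / x 12.
pose u0 := x 10; pose w0 := x 11; pose u1 := x 8 * (y1 * y2 * y3 * y4) / u0.
pose w1 := (x 8 + x 9) * (y1 * y2 * y3 * y4) / x 11.
pose s0 := x 6 * (y2 * y3 * y4).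
pose q1 := x 1 * y4; pose q0 := x 4 * (y3 * y4) / q1.
(* The products p1 p2, p2 p3 and p1 p2 p3 are found first, from the values at 7, 5 and 2; their
   quotients then isolate the factors. *)
pose p12 := x 7 * w1 / x 9.
pose u2 := (s0 * w1 + x 9 * p12 * (y2 * y3 * y4)) / (u0 * u1).
pose p23 := x 5 * (u1 * u2) / (x 9 * p12).
pose s1 := (x 9 * p12 * p23 * (y3 * y4) + q0 * q1 * u1 * u2) / s0.
pose p123 := x 2 * s1 / q1.
pose p3 := p123 / p12; pose p2 := p23 / p3; pose p1 := p12 / p2; pose p0 := x 9 / p1.
pose k0 := x 3 * u2 / p123.
have y0P : 0 < y0 by exact: x0.
have y1P : 0 < y1 by do ?[exact: x0|done|apply: divr_gt0|apply: mulr_gt0|apply: addr_gt0].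
have y2P : 0 < y2 by do ?[exact: x0|done|apply: divr_gt0|apply: mulr_gt0|apply: addr_gt0].
have y3P : 0 < y3 by do ?[exact: x0|done|apply: divr_gt0|apply: mulr_gt0|apply: addr_gt0].
have y4P : 0 < y4 by do ?[exact: x0|done|apply: divr_gt0|apply: mulr_gt0|apply: addr_gt0].
have u0P : 0 < u0 by exact: x0.
have u1P : 0 < u1 by do ?[exact: x0|done|apply: divr_gt0|apply: mulr_gt0|apply: addr_gt0].
have w0P : 0 < w0 by exact: x0.
have w1P : 0 < w1 by do ?[exact: x0|done|apply: divr_gt0|apply: mulr_gt0|apply: addr_gt0].
have s0P : 0 < s0 by do ?[exact: x0|done|apply: divr_gt0|apply: mulr_gt0|apply: addr_gt0].
have q1P : 0 < q1 by do ?[exact: x0|done|apply: divr_gt0|apply: mulr_gt0|apply: addr_gt0].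
have q0P : 0 < q0 by do ?[exact: x0|done|apply: divr_gt0|apply: mulr_gt0|apply: addr_gt0].
have p12P : 0 < p12 by do ?[exact: x0|done|apply: divr_gt0|apply: mulr_gt0|apply: addr_gt0].
have u2P : 0 < u2 by do ?[exact: x0|done|apply: divr_gt0|apply: mulr_gt0|apply: addr_gt0].
have p23P : 0 < p23 by do ?[exact: x0|done|apply: divr_gt0|apply: mulr_gt0|apply: addr_gt0].
have s1P : 0 < s1 by do ?[exact: x0|done|apply: divr_gt0|apply: mulr_gt0|apply: addr_gt0].
have p123P : 0 < p123 by do ?[exact: x0|done|apply: divr_gt0|apply: mulr_gt0|apply: addr_gt0].
have p3P : 0 < p3 by do ?[exact: x0|done|apply: divr_gt0|apply: mulr_gt0|apply: addr_gt0].
have p2P : 0 < p2 by do ?[exact: x0|done|apply: divr_gt0|apply: mulr_gt0|apply: addr_gt0].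
have p1P : 0 < p1 by do ?[exact: x0|done|apply: divr_gt0|apply: mulr_gt0|apply: addr_gt0].
have p0P : 0 < p0 by do ?[exact: x0|done|apply: divr_gt0|apply: mulr_gt0|apply: addr_gt0].
have k0P : 0 < k0 by do ?[exact: x0|done|apply: divr_gt0|apply: mulr_gt0|apply: addr_gt0].
have e01 : p0 * p1 = x 9 by rewrite divfK ?gt_eqF.
have e12 : p1 * p2 = p12 by rewrite divfK ?gt_eqF.
have e23 : p2 * p3 = p23 by rewrite divfK ?gt_eqF.
have e123 : p1 * p2 * p3 = p123 by rewrite e12 mulrC divfK ?gt_eqF.
have e012 : p0 * p1 ^+ 2 * p2 = x 9 * p12 by rewrite -e01 -e12; ring.
have e0123 : p0 * p1 ^+ 2 * p2 ^+ 2 * p3 = x 9 * p12 * p23.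
  by rewrite -e01 -e12 -e23; ring.
have y12 : y0 * y1 = x 14 by rewrite /y1 mulrC divfK.
have y13 : y0 * y1 * y2 = x 13 by rewrite y12 /y2 mulrC divfK.
have y14 : y0 * y1 * y2 * y3 = x 12 by rewrite y13 /y3 mulrC divfK.
have yy : y1 * y2 * y3 * y4 != 0 by apply: lt0r_neq0; do ?[done|apply: mulr_gt0].
have yyy : y2 * y3 * y4 != 0 by apply: lt0r_neq0; do ?[done|apply: mulr_gt0].
have yyyy : y3 * y4 != 0 by apply: lt0r_neq0; do ?[done|apply: mulr_gt0].
have solve (a b c : F) : 0 < a -> a * b = c -> b = c / a.
  by move=> a0 <-; rewrite mulrAC mulfV ?mul1r ?gt_eqF.
have uu : u0 * u1 = x 8 * (y1 * y2 * y3 * y4) by rewrite mulrC divfK ?gt_eqF.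
exists y0, y1, y2, y3, p0, p1, p2, p3, u0, u1, w0, q0, q1, s0, k0; split=> //.
move=> y p u w q s k ts.
move=> [[Y0 Y1 Y2 Y3] [P0 P1 P2 P3] [U0 U1 W0] [Q0 Q1 S0 K0]].
have Y4 : y 4 = y4.
  apply: solve (x0 12) _; rewrite -y14 -/u0 -/w0.
  by have := ts1 ts 0; rewrite Y0 Y1 Y2 Y3 U0 W0.
have W1 : w 1%N = w1.
  apply: solve w0P _; have := ts2 ts 0; rewrite Y1 Y2 Y3 Y4 U0 U1 P0 P1 W0 => <-.
  by rewrite uu e01 mulrDl.
have U2 : u 2 = u2.
  apply: (solve (u0 * u1)); first exact: mulr_gt0.
  have := ts3 ts 0.
  by rewrite Y2 Y3 Y4 U0 U1 P0 P1 P2 W1 S0 e012 => <-.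
have S1 : s 1%N = s1.
  apply: solve s0P _; have := ts6 ts 0.
  by rewrite Y3 Y4 U1 U2 P0 P1 P2 P3 Q0 Q1 S0 e0123 => <-.
move=> v Dv; have {Dv} : v \in iota 1 15 := Dv.
rewrite !inE => /orP[|]; last do 13?[case/orP=> [|]]; move=> /eqP ->;
  rewrite /= ?Y0 ?Y1 ?Y2 ?Y3 ?Y4 ?P0 ?P1 ?P2 ?P3 ?U0 ?U1 ?U2 ?W0 ?W1 ?Q0 ?Q1 ?S0 ?S1 ?K0 //.
- by rewrite mulfK ?gt_eqF.
- by rewrite e123 /p123 divfK ?mulfK ?gt_eqF.
- by rewrite e123 /k0 divfK ?mulfK ?gt_eqF.
- by rewrite /q0 divfK ?gt_eqF // mulfK.
- by rewrite e0123 /p23; field; rewrite !gt_eqF.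
- by rewrite mulfK.
- by rewrite e012 /p12; field; rewrite xn gt_eqF.
- by rewrite uu mulfK.
Qed.

End H3Seed.

(** The recursion removes ten successors at once, so a shift of the index by ten is a definitional
    equality. *)
Fixpoint cyc10 (T : Type) (a : T) (l : seq T) (t : nat) : T :=
  if t is t'.+4.+4.+2 then cyc10 a l t' else nth a l t.

Lemma nat10_ind (Q : nat -> Prop) :
  Q 0 -> Q 1 -> Q 2 -> Q 3 -> Q 4 -> Q 5 -> Q 6 -> Q 7 -> Q 8 -> Q 9 ->
  (forall t, Q t -> Q t.+4.+4.+2) -> forall t, Q t.
Proof.
move=> Q0 Q1 Q2 Q3 Q4 Q5 Q6 Q7 Q8 Q9 QS t.
have [k] := ubnP t; elim: k t => // k IH.
by do 10![case=> //]; move=> t tk; apply/QS/IH; lia.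
Qed.

(* The seed consists of the fifteen variables below; the other terms are the
   Laurent polynomials obtained from it by running the T-system, written in the
   shortest form that involves division by seed variables only. *)
Section H3Sequences.
Context (F : realFieldType).
Context (y0 y1 y2 y3 p0 p1 p2 p3 u0 u1 w0 q0 q1 s0 k : F).
Context (y0_neq0 : (y0 != 0)%R) (y1_neq0 : (y1 != 0)%R) (y2_neq0 : (y2 != 0)%R).
Context (y3_neq0 : (y3 != 0)%R) (p0_neq0 : (p0 != 0)%R) (p1_neq0 : (p1 != 0)%R).
Context (p2_neq0 : (p2 != 0)%R) (p3_neq0 : (p3 != 0)%R) (u0_neq0 : (u0 != 0)%R).
Context (u1_neq0 : (u1 != 0)%R) (w0_neq0 : (w0 != 0)%R) (q0_neq0 : (q0 != 0)%R).
Context (q1_neq0 : (q1 != 0)%R) (s0_neq0 : (s0 != 0)%R) (k_neq0 : (k != 0)%R).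
Local Open Scope ring_scope.

Let y4 : F := (u0 + w0) / (y0 * y1 * y2 * y3).
Let y5 : F := (y0 * u1 + p0 * p1) / w0.
Let y6 : F := (y1 * s0 + p1 * p2 * w0) / (u0 * u1).
Let y7 : F := (y2 * q0 * q1 + p2 * p3 * u0) / s0.
Let q9 : F := (y3 * p0 * p1 * p2 + s0) / (q0 * q1).
Let p9 : F := (u1 * q0 * k + s0) / (p0 * p1 * p2 * p3 * k).
Let y8 : F := (q1 * q9 + u1 * k) / (p0 * p1 * p2).
Let w1 : F := (y5 * u0 + p0 * p1) / y0.
Let u2 : F := (s0 * w1 + p0 * p1 ^+ 2 * p2 * y2 * y3 * y4) / (u0 * u1).
Let s1 : F := (q0 * q1 * w1 + p0 * p1 ^+ 2 * p2 * y3 * y4 * y7) / u0.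
Let p4 : F := (q1 * u2 + k * s1) / (p0 * p1 * p2 * p3).
Let y9 : F := (p0 * p4 + k * y4) / (k * q1).
Let p8 : F := k * (p0 * p1 * y3 * y7 + p3 * u0) / (q0 * q1).
Let p7 : F := (p0 * p9 * q1 * y2 * y6 + p2 * w0) / (s0 * k).
Let p6 : F := k * (k * p3 * p9 * y1 * y5 + p1) / u1.
Let p5 : F := (p2 * p8 * y0 * y4 + k * p0) / (u0 * k ^+ 2).
Let q2 : F := (s1 + p1 * p2 * p3 * y4) / (q0 * q1).
Let w2 : F := (y6 * u1 + p1 * p2) / y1.
Let q3 : F := (k * p2 * p3 * p9 * y5 + w2) / u1.
Let q4 : F := (k * p3 * p7 + y7) / y2.
Let q5 : F := (p4 * p8 / k + y8) / y3.
Let u9 : F := (y2 * y3 * y6 * p0 ^+ 2 * p1 * p9 + w0 * q0 * q9) / s0.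
Let w9 : F := y9 * y0 * y1 * y2 * y3 - u9.
Let q6 : F := (y0 * p2 * p8 * p9 / k + w9) / u0.
Let q7 : F := (y1 * p0 * p3 * p9 * k + w0) / u1.
Let q8 : F := (p0 * p1 * p9 * y2 * q1 + u0 * u1) / s0.
Let u3 : F := (y7 * w2 - p2 * p3) / y2.
Let w3 : F := (y7 * u2 + p2 * p3) / y2.
Let u4 : F := (y8 * w3 - p3 * p4) / y3.
Let w4 : F := (y8 * u3 + p3 * p4) / y3.
Let u8 : F := (y8 * w9 - p8 * p9) / y3.
Let w8 : F := (y8 * u9 + p8 * p9) / y3.
Let u7 : F := (y7 * w8 - p7 * p8) / y2.
Let w7 : F := (y7 * u8 + p7 * p8) / y2.
Let u6 : F := (y6 * w7 - p6 * p7) / y1.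
Let w6 : F := (y6 * u7 + p6 * p7) / y1.
Let u5 : F := (y5 * w6 - p5 * p6) / y0.
Let w5 : F := (y5 * u6 + p5 * p6) / y0.
Let s2 : F := q1 * q2 * q3 - p2 * p3 * p4 * y5.
Let s3 : F := q2 * q3 * q4 - p3 * p4 * p5 * y6.
Let s4 : F := q3 * q4 * q5 - p4 * p5 * p6 * y7.
Let s5 : F := q4 * q5 * q6 - p5 * p6 * p7 * y8.
Let s6 : F := q5 * q6 * q7 - p6 * p7 * p8 * y9.
Let s7 : F := q6 * q7 * q8 - p7 * p8 * p9 * y0.
Let s8 : F := q7 * q8 * q9 - p8 * p9 * p0 * y1.
Let s9 : F := q8 * q9 * q0 - p9 * p0 * p1 * y2.

Let y := cyc10 0 [:: y0; y1; y2; y3; y4; y5; y6; y7; y8; y9].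
Let p := cyc10 0 [:: p0; p1; p2; p3; p4; p5; p6; p7; p8; p9].
Let u := cyc10 0 [:: u0; u1; u2; u3; u4; u5; u6; u7; u8; u9].
Let w := cyc10 0 [:: w0; w1; w2; w3; w4; w5; w6; w7; w8; w9].
Let q := cyc10 0 [:: q0; q1; q2; q3; q4; q5; q6; q7; q8; q9].
Let s := cyc10 0 [:: s0; s1; s2; s3; s4; s5; s6; s7; s8; s9].
Let kk := cyc10 0 [:: k; k^-1; k; k^-1; k; k^-1; k; k^-1; k; k^-1].

Let seed_neq0 := (y0_neq0, y1_neq0, y2_neq0, y3_neq0, p0_neq0, p1_neq0, p2_neq0,
  p3_neq0, u0_neq0, u1_neq0, w0_neq0, q0_neq0, q1_neq0, s0_neq0, k_neq0).

Ltac laurent := rewrite /y /p /u /w /q /s /kk /=;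
  rewrite /s9 /s8 /s7 /s6 /s5 /s4 /s3 /s2 /w5 /u5 /w6 /u6 /w7 /u7 /w8 /u8 /w4 /u4 /w3
  /u3 /q8 /q7 /q6 /w9 /u9 /q5 /q4 /q3 /w2 /q2 /p5 /p6 /p7 /p8 /y9 /p4 /s1 /u2
  /w1 /y8 /p9 /q9 /y7 /y6 /y5 /y4;
  field; by rewrite ?seed_neq0.

Let rel1 t : u t + w t = y t * y t.+1 * y t.+2 * y t.+3 * y t.+4.
Proof. by elim/nat10_ind: t => [||||||||||t //]; laurent. Qed.

(** A substitute of lower degree for [ts2], which follows from it and [rel1] at two consecutive
    times. *)
Let rel2 t : y t * w t.+1 = y t.+4.+1 * u t + p t * p t.+1.
Proof. by elim/nat10_ind: t => [||||||||||t //]; laurent. Qed.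

Let rel3 t : s t * w t.+1 + p t * p t.+1 ^+ 2 * p t.+2 * (y t.+2 * y t.+3 * y t.+4)
  = u t * u t.+1 * u t.+2.
Proof. by elim/nat10_ind: t => [||||||||||t //]; laurent. Qed.

Let rel4 t : s t.+1 + p t.+1 * p t.+2 * p t.+3 * y t.+4 = q t * q t.+1 * q t.+2.
Proof. by elim/nat10_ind: t => [||||||||||t //]; laurent. Qed.

Let rel5 t : q t.+1 * u t.+2 + kk t * s t.+1 = p t * p t.+1 * p t.+2 * p t.+3 * p t.+4.
Proof. by elim/nat10_ind: t => [||||||||||t //]; laurent. Qed.

(** A substitute of lower degree for [ts6], which follows from it, [relk] and [rel5] at two
    consecutive times. *)
Let rel6 t : p t * kk t.+1 * s t.+2 =
  p t.+4.+1 * q t.+1 * u t.+2 + p t.+2 * p t.+3 * (y t.+4 * y t.+4.+1).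
Proof. by elim/nat10_ind: t => [||||||||||t //]; laurent. Qed.

Let relk t : kk t * kk t.+1 = 1.
Proof.
by elim/nat10_ind: t => [||||||||||t //]; rewrite /kk /=; (rewrite mulfV || rewrite mulVf).
Qed.

Lemma H3_sequences : exists y p u w q s k' : nat -> F,
  [/\ tsystem y p u w q s k',
    [/\ [/\ y 0 = y0, y 1 = y1, y 2 = y2 & y 3 = y3],
        [/\ p 0 = p0, p 1 = p1, p 2 = p2 & p 3 = p3],
        [/\ u 0 = u0, u 1 = u1 & w 0 = w0] &
        [/\ q 0 = q0, q 1 = q1, s 0 = s0 & k' 0 = k]]%N &
    forall v, ts_x y p u w q s k' 10 v = ts_x y p u w q s k' 0 v].
Proof.
exists y, p, u, w, q, s, kk; split=> //; split=> // t.
- have r1 := rel1 t; have r1' := rel1 t.+1; have r2 := rel2 t.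
  set Y := y t.+1 * y t.+2 * y t.+3 * y t.+4.
  have e1 : y t * Y * w t.+1 = (u t + w t) * w t.+1 by rewrite r1 /Y; ring.
  have e2 : y t.+4.+1 * Y * u t = (u t.+1 + w t.+1) * u t by rewrite r1' /Y; ring.
  have e3 : y t * Y * w t.+1 = y t.+4.+1 * Y * u t + p t * p t.+1 * Y.
    by rewrite mulrAC r2; ring.
  by move: e3; rewrite e1 e2; lra.
- have H t' : p t'.+1 * p t'.+2 ^+ 2 * p t'.+3 ^+ 2 * p t'.+4 * (y t'.+4 * y t'.+4.+1)
      + q t'.+1 * q t'.+2 * u t'.+2 * u t'.+3 = s t'.+1 * s t'.+2.
    have r5 := rel5 t'; have r5' := rel5 t'.+1; have r6 := rel6 t'; have rk := relk t'.
    pose A := p t'.+1 * p t'.+2 * p t'.+3 * p t'.+4.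
    have e5 : q t'.+1 * u t'.+2 = p t' * A - kk t' * s t'.+1.
      by apply/eqP; rewrite eq_sym subr_eq r5 /A; apply/eqP; ring.
    have e5' : q t'.+2 * u t'.+3 = p t'.+4.+1 * A - kk t'.+1 * s t'.+2.
      by apply/eqP; rewrite eq_sym subr_eq r5' /A; apply/eqP; ring.
    have -> : p t'.+1 * p t'.+2 ^+ 2 * p t'.+3 ^+ 2 * p t'.+4 * (y t'.+4 * y t'.+4.+1) =
        A * (p t' * kk t'.+1 * s t'.+2 - p t'.+4.+1 * (q t'.+1 * u t'.+2)).
      by rewrite r6 /A; ring.
    have -> : q t'.+1 * q t'.+2 * u t'.+2 * u t'.+3 =
        (q t'.+1 * u t'.+2) * (q t'.+2 * u t'.+3) by ring.
    rewrite e5' e5; have -> : s t'.+1 * s t'.+2 = kk t' * kk t'.+1 * (s t'.+1 * s t'.+2).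
      by rewrite rk mul1r.
    ring.
  (* The derivation yields the relation at t' + 1; for t' = t + 9 the index t + 10 reduces to t. *)
  exact: (H t.+4.+4.+1).
Qed.

End H3Sequences.

(** The seed of [x 0] generates a T-system whose orbit agrees with [x] at time 0, hence at all times
    by [BRstep_inj], and its sequences have period 10. *)
Lemma H3_BR_period (F : realFieldType) (x : nat -> nat -> F) :
  BRorbit H3_graph x -> {in dom H3_graph, x 10 =1 x 0}.
Proof.
move=> [x0 xs].
have [y0 [y1 [y2 [y3 [p0 [p1 [p2 [p3 [u0 [u1 [w0 [q0 [q1 [s0 [k0 [pos H]]]]]]]]]]]]]]]] :=
  H3_seed (x0 0).
have := pos => -[[y0P y1P y2P y3P] [p0P p1P p2P p3P] [u0P u1P w0P] [q0P q1P s0P k0P]].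
have [y [p [u [w [q [s [k [ts ini per]]]]]]]] := H3_sequences
  (lt0r_neq0 y0P) (lt0r_neq0 y1P) (lt0r_neq0 y2P) (lt0r_neq0 y3P) (lt0r_neq0 p0P)
  (lt0r_neq0 p1P) (lt0r_neq0 p2P) (lt0r_neq0 p3P) (lt0r_neq0 u0P) (lt0r_neq0 u1P)
  (lt0r_neq0 w0P) (lt0r_neq0 q0P) (lt0r_neq0 q1P) (lt0r_neq0 s0P) (lt0r_neq0 k0P).
have tpos : ts_pos y p u w q s k 0.
  case: ini => -[Y0 Y1 Y2 Y3] [P0 P1 P2 P3] [U0 U1 W0] [Q0 Q1 S0 K0].
  by split; split; rewrite ?(Y0, Y1, Y2, Y3, P0, P1, P2, P3, U0, U1, W0, Q0, Q1, S0, K0).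
have agree t : {in dom H3_graph, x t =1 ts_x y p u w q s k t}.
  elim: t => [|t IH]; first by move=> v Dv; rewrite H.
  exact: (BRstep_inj (x0 t) (x0 t.+1) (xs t) (ts_x_step ts tpos t) IH).
by move=> v Dv; rewrite !agree // per.
Qed.

Lemma hnum_PhiH3 : hnum PhiH3 = 10.
Proof. by rewrite (hnum_labelled H3_labelling (H3_elt 1)). Qed.

(** Birational orbits that agree at times 10 and 0 have equal exponents there, and the normalization
    is injective. *)
Lemma order_PhiH3 (R : realType) (ell : nat) (s : seq PhiH3) : 0 < ell ->
  linear_extension s -> #[rowmotion_perm R ell s]%g = hnum PhiH3.
Proof.
move=> ell0 sle; apply: (order_period (l := H3_labelling) ell0 sle (H3_elt 1)) => T v Dv.
have [X [Xorb Xa]] := tropicalization R (nrow_orbit_step H3_labelling R ell0 sle T).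
apply: (normalize_inj (G := H3_graph) (L := ell%:Z)).
apply: asymp_inj (Xa 10 v Dv) _; apply: eq_asymp (Xa 0 v Dv) => z z1.
by rewrite (H3_BR_period (Xorb z z1)).
Qed.

(** * The orders in all coincidental types *)

Theorem theorem4p27 (R : realType) (ell : nat) (ell_ge1 : 1 <= ell) :
  [/\ forall n : nat, 1 <= n ->
        hnum (PhiA n) = n + 1 /\
        (2 <= n -> forall s : seq (PhiA n), linear_extension s ->
           #[rowmotion_perm R ell s]%g = 2 * hnum (PhiA n)),
      forall n : nat, 1 <= n ->
        hnum (PhiB n) = 2 * n /\
        (forall s : seq (PhiB n), linear_extension s ->
           #[rowmotion_perm R ell s]%g = hnum (PhiB n)),
      hnum PhiH3 = 10 /\
      (forall s : seq PhiH3, linear_extension s ->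
         #[rowmotion_perm R ell s]%g = hnum PhiH3)
    & forall m : nat, 2 <= m ->
        hnum (PhiI2 m) = m /\
        (forall s : seq (PhiI2 m), linear_extension s ->
           #[rowmotion_perm R ell s]%g =
             if odd m then 2 * hnum (PhiI2 m) else hnum (PhiI2 m))].
Proof.
split.
- move=> n n0; split=> [|n1 s sle]; first by rewrite hnum_PhiA // addn1.
  exact: order_PhiA.
- by move=> n n0; split=> [|s sle]; [exact: hnum_PhiB|exact: order_PhiB].
- by split=> [|s sle]; [exact: hnum_PhiH3|exact: order_PhiH3].
- by move=> m m1; split=> [|s sle]; [exact: hnum_PhiI2|exact: order_PhiI2].
Qed.
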